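(* Let $S$ be a set of $n$ trajectories and $k$ be a positive integer. For every $\varepsilon>0$, the algorithm $k$-clusteringBS$_\varepsilon(S,k)$ (described in the context) is a $\left((4+\sqrt{2})/2+\varepsilon\right)$-approximation for the max diameter kinetic 1D $k$-clustering problem. That is, for fixed $\varepsilon$ it runs in time polynomial in the input size and returns a $k$-clustering $\mathcal{C}$ of $S$ with $$\operatorname{md}(\mathcal{C})\ \leq\ \left(\frac{4+\sqrt{2}}{2}+\varepsilon\right)\operatorname{md}^*(S,k).$$
   Context: A trajectory $i$ is given by a pair of real numbers $(x_i(0),v_i)$ and is identified with the affine function $x_i(t)=x_i(0)+v_i t$, $t\in[0,1]$. Distinct elements of a set of trajectories are distinct functions; all sets of trajectories are finite. A cluster of $S$ is a (possibly empty) subset of $S$. A $k$-clustering of $S$ is a partition of $S$ into $k$ clusters, where empty clusters are allowed (so a $k'$-clustering with $k'<k$ is regarded as a $k$-clustering by adding empty clusters); it is assumed throughout that $1\leq k\leq |S|$. The diameter of a nonempty cluster $C$ is $\operatorname{diam}(C)=\int_0^1\left(\max_{i\in C}x_i(t)-\min_{i\in C}x_i(t)\right)\mathrm{d}t$, and $\operatorname{diam}(\emptyset)=0$. For a $k$-clustering $\mathcal{C}$, $\operatorname{md}(\mathcal{C})=\max_{C\in\mathcal{C}}\operatorname{diam}(C)$, and $\operatorname{md}^*(S,k)$ is the minimum of $\operatorname{md}(\mathcal{C})$ over all $k$-clusterings $\mathcal{C}$ of $S$. The max diameter kinetic 1D $k$-clustering problem asks, given $S$ and $k$, for a $k$-clustering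 attaining $\operatorname{md}^*(S,k)$. Here $\varepsilon$ is not part of the input. The leftmost trajectory of $S$ is the $s\in S$ with $x_s(0)$ minimum and, in case of ties, with $x_s(1)$ minimum among the tied trajectories. Algorithm GreedyPartition$(S,D)$, for a real $D\ge 0$: if $S=\emptyset$, return $\emptyset$. Otherwise let $s$ be the leftmost trajectory in $S$, let $C=\{s'\in S : \operatorname{diam}(\{s,s'\})\leq D\}$, and return $\{C\}\cup$ GreedyPartition$(S\setminus C,D)$. Algorithm $k$-clusteringBS$_\varepsilon(S,k)$: set $a\gets 0$, $b\gets\operatorname{diam}(S)$, and $\delta\gets\frac{2\varepsilon}{4+\sqrt2}\min_{u,v\in S,\,u\neq v}\operatorname{diam}(\{u,v\})$. While $b-a>\delta$: set $D\gets (a+b)/2$ and $\mathcal{C}\gets$ GreedyPartition$(S,D)$; if $|\mathcal{C}|>k$ then set $a\gets D$, else set $b\gets D$. After the loop, if $|\mathcal{C}|>k$ return GreedyPartition$(S,b)$, else return $\mathcal{C}$.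
   Formalization: When k = n ≥ 2 the inequality is proved only for ε < (4+√2)/2; for larger ε it fails (two trajectories, k = 2: the loop does not run and one cluster of positive diameter is returned while md* = 0). *)

(* Defs.v *)
From HB Require Import structures.
From mathcomp Require Import all_boot all_order all_algebra finmap.
From mathcomp Require Import all_classical all_reals all_analysis.

Set Implicit Arguments.
Unset Strict Implicit.
Unset Printing Implicit Defensive.
Import Order.TTheory GRing.Theory Num.Theory.
Local Open Scope ring_scope.

(* A while loop: [While test body st st'] says that the loop started in state
   [st] terminates, in state [st'].  There is no constructor for a diverging
   run, so a proof of [While] includes a proof of termination. *)
Inductive While (St : Type) (test : St -> bool) (body : St -> St) :
    St -> St -> Prop :=
| While_stop st : test st = false -> While test body st st
| While_step st st' : test st = true -> While test body (body st) st' ->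
    While test body st st'.

Section Kinetic.
Variable R : realType.

(* The pair (x(0), v); it stands for the function t |-> x(0) + v t on [0, 1].
   Distinct pairs give distinct functions. *)
Definition traj : Type := (R * R)%type.
Implicit Types (i s u v : traj) (C S : {fset traj}) (CC : seq {fset traj}).

Definition pos i (t : R) : R := i.1 + i.2 * t.

(* [sup] and [inf] of a nonempty finite set are its maximum and minimum. *)
Definition width C (t : R) : R :=
  sup [set pos i t | i in [set` C]]%classic -
  inf [set pos i t | i in [set` C]]%classic.

Definition diam C : R :=
  if C == fset0 then 0
  else \int[lebesgue_measure]_(t in `[0, 1]%classic) width C t.

(* Clusterings are lists of clusters; clusters may be empty (and the empty
   cluster may be repeated).  A clustering with fewer than k clusters counts as
   a k-clustering, the missing clusters being empty. *)
Definition kclustering S (k : nat) CC : Prop :=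
  [/\ (size CC <= k)%N,
      pairwise (fun C C' => [disjoint C & C']%fset) CC
    & (\bigcup_(C <- CC) C)%fset = S].

Definition md CC : R := \big[Num.max/0]_(C <- CC) diam C.

(* [md] takes finitely many values on the k-clusterings of S, and there is at
   least one k-clustering when k >= 1, so the infimum is a minimum. *)
Definition md_star S (k : nat) : R :=
  inf [set md CC | CC in [set CC | kclustering S k CC]]%classic.

(* The leftmost trajectory; the default value is only met when S is empty. *)
Definition is_leftmost S s : Prop :=
  s \in S /\ forall u, u \in S ->
    pos s 0 < pos u 0 \/ (pos s 0 = pos u 0 /\ pos s 1 <= pos u 1).

Definition leftmost S : traj := xget (0, 0) [set s | is_leftmost S s]%classic.

(* The first argument bounds the depth of the recursion.  For D >= 0 every
   call removes at least the leftmost trajectory from S, so that #|` S| is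
   enough depth for the recursion to end with S = fset0. *)
Fixpoint greedy_rec (depth : nat) S (D : R) : seq {fset traj} :=
  if depth is depth'.+1 then
    if S == fset0 then [::] else
    let s := leftmost S in
    let C := [fset s' in S | diam [fset s; s']%fset <= D]%fset in
    C :: greedy_rec depth' (S `\` C)%fset D
  else [::].

Definition GreedyPartition S (D : R) : seq {fset traj} :=
  greedy_rec #|` S| S D.

(* If S has a single trajectory, this is [inf set0], which is 0; the loop below
   does not run in that case, as diam S = 0. *)
Definition min_pair_diam S : R :=
  inf [set d | exists u v,
        [/\ u \in S, v \in S, u <> v & d = diam [fset u; v]%fset]]%classic.

(* With delta = delta_coef eps * min_pair_diam S, one has
   delta < min_pair_diam S if and only if eps < (4 + sqrt 2) / 2.  For larger
   eps the loop may stop with b >= min_pair_diam S; when k = #|` S| > 1, where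
   md_star S k = 0, the algorithm may then return a cluster with two
   trajectories, and no bound by a multiple of md_star S k holds.  For
   k < #|` S| this does not matter, as md_star S k >= min_pair_diam S. *)
Definition delta_coef (eps : R) : R := 2 * eps / (4 + Num.sqrt 2).

(* The state (a, b, last clustering computed).  The third component is [None]
   as long as the body of the loop has not been run. *)
Definition bs_state : Type := (R * R * option (seq {fset traj}))%type.

Definition bs_init S : bs_state := (0, diam S, None).

Definition bs_test (eps : R) S (st : bs_state) : bool :=
  let: (a, b, _) := st in delta_coef eps * min_pair_diam S < b - a.

Definition bs_body S (k : nat) (st : bs_state) : bs_state :=
  let: (a, b, _) := st in
  let D := (a + b) / 2 in
  let G := GreedyPartition S D in
  if (k < size G)%N then (D, b, Some G) else (a, D, Some G).

Definition bs_return S (k : nat) (st : bs_state) : seq {fset traj} :=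
  let: (_, b, last) := st in
  if last is Some G then
    if (k < size G)%N then GreedyPartition S b else G
  else GreedyPartition S b.

(* The algorithm terminates on (S, k) and returns CC. *)
Definition kclusteringBS (eps : R) S (k : nat) CC : Prop :=
  exists2 st, While (bs_test eps S) (bs_body S k) (bs_init S) st
            & CC = bs_return S k st.

End Kinetic.

(* Running time.  The input consists of rational numbers in binary, and the
   algorithm is implemented below with exact rational arithmetic, the rationals
   being kept in lowest terms.  A computation returns its result with the number
   of bit operations it is charged. *)

Definition nbits (n : nat) : nat := (trunc_log 2 n).+1.
Definition bits (x : rat) : nat := (1 + nbits `|numq x| + nbits `|denq x|)%N.

Definition input_size (s : seq (rat * rat)) (k : nat) : nat :=
  (nbits k + \sum_(u <- s) (bits u.1 + bits u.2))%N.

Definition timed (A : Type) : Type := (A * nat)%type.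

(* Every [ret] and every [bind] costs one step, which accounts for control flow
   and for the handling of lists. *)
Definition ret (A : Type) (x : A) : timed A := (x, 1%N).
Definition bind (A B : Type) (m : timed A) (f : A -> timed B) : timed B :=
  ((f m.1).1, (m.2 + (f m.1).2).+1).
Notation "'let!' x := m 'in' f" := (bind m (fun x => f))
  (at level 200, x name, m at level 100, f at level 200,
   format "'[v' 'let!'  x  :=  m  'in' '/' f ']'").

(* Arithmetic operations and comparisons are charged quadratically in the length
   of their operands, as in schoolbook arithmetic with reduction of
   fractions. *)
Definition opcost (x y : rat) : nat := ((1 + bits x + bits y) ^ 2)%N.

Definition addT (x y : rat) : timed rat := (x + y, opcost x y).
Definition subT (x y : rat) : timed rat := (x - y, opcost x y).
Definition mulT (x y : rat) : timed rat := (x * y, opcost x y).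
Definition divT (x y : rat) : timed rat := (x / y, opcost x y).
Definition absT (x : rat) : timed rat := (`|x|, opcost x 0).
Definition eqT (x y : rat) : timed bool := (x == y, opcost x y).
Definition leT (x y : rat) : timed bool := (x <= y, opcost x y).
Definition ltT (x y : rat) : timed bool := (x < y, opcost x y).

Definition minT (x y : rat) : timed rat :=
  let! c := leT x y in ret (if c then x else y).
Definition maxT (x y : rat) : timed rat :=
  let! c := leT x y in ret (if c then y else x).

(* Whether the list G has more than k items. *)
Definition longerT (A : Type) (G : seq A) (k : nat) : timed bool :=
  ((k < size G)%N, ((1 + size G + nbits k) ^ 2)%N).

(* Comparison with a multiple of a fixed real number c.  The machine is built
   for one value of c, which is not part of its input; no other operation
   involves real numbers. *)
Definition gt_multipleT (R : realType) (c : R) (m w : rat) : timed bool :=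
  (c * ratr m < ratr w, opcost m w).

Definition qtraj : Type := (rat * rat)%type.

Definition posT (u : qtraj) (t : rat) : timed rat :=
  let! y := mulT u.2 t in addT u.1 y.

(* With d0 and d1 the differences of the two trajectories at times 0 and 1, the
   integral over [0, 1] of |d0 + (d1 - d0) t| is |d0 + d1| / 2 when d0 and d1
   have the same sign, and is the total area of two triangles otherwise. *)
Definition pair_diamT (u v : qtraj) : timed rat :=
  let! d0 := subT u.1 v.1 in
  let! dv := subT u.2 v.2 in
  let! d1 := addT d0 dv in
  let! p := mulT d0 d1 in
  let! same_sign := leT 0 p in
  if same_sign then
    let! s := addT d0 d1 in
    let! a := absT s in
    divT a 2
  else
    let! q0 := mulT d0 d0 in
    let! q1 := mulT d1 d1 in
    let! q := addT q0 q1 in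
    let! a := absT dv in
    let! a2 := mulT 2 a in
    divT q a2.

(* The diameter of a list of trajectories: the width is affine between
   consecutive crossing times, so the trapezoidal rule on the sorted list of
   crossing times in ]0, 1[ is exact. *)
Fixpoint insertT (x : rat) (ts : seq rat) : timed (seq rat) :=
  if ts is t :: ts' then
    let! c := leT x t in
    if c then ret (x :: ts)
    else let! r := insertT x ts' in ret (t :: r)
  else ret [:: x].

Fixpoint cross_rowT (u : qtraj) (s : seq qtraj) (ts : seq rat) :
    timed (seq rat) :=
  if s is v :: s' then
    let! dv := subT u.2 v.2 in
    let! parallel := eqT dv 0 in
    if parallel then cross_rowT u s' ts else
    let! dx := subT v.1 u.1 in
    let! t := divT dx dv in
    let! gt0 := ltT 0 t in
    let! lt1 := ltT t 1 in
    if gt0 && lt1 then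
      let! ts' := insertT t ts in cross_rowT u s' ts'
    else cross_rowT u s' ts
  else ret ts.

Fixpoint crossT (s : seq qtraj) (ts : seq rat) : timed (seq rat) :=
  if s is u :: s' then
    let! ts' := cross_rowT u s' ts in crossT s' ts'
  else ret ts.

Fixpoint extremaT (s : seq qtraj) (t lo hi : rat) : timed (rat * rat) :=
  if s is u :: s' then
    let! x := posT u t in
    let! lo' := minT lo x in
    let! hi' := maxT hi x in
    extremaT s' t lo' hi'
  else ret (lo, hi).

Definition widthT (s : seq qtraj) (t : rat) : timed rat :=
  if s is u :: s' then
    let! x := posT u t in
    let! e := extremaT s' t x x in
    subT e.2 e.1
  else ret 0.

Fixpoint sweepT (s : seq qtraj) (t0 w0 : rat) (ts : seq rat) : timed rat :=
  if ts is t1 :: ts' then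
    let! w1 := widthT s t1 in
    let! h := subT t1 t0 in
    let! w := addT w0 w1 in
    let! p := mulT h w in
    let! area := divT p 2 in
    let! rest := sweepT s t1 w1 ts' in
    addT area rest
  else ret 0.

Definition diamT (s : seq qtraj) : timed rat :=
  let! ts := crossT s [:: 1] in
  let! w0 := widthT s 0 in
  sweepT s 0 w0 ts.

Fixpoint min_rowT (u : qtraj) (s : seq qtraj) (acc : option rat) :
    timed (option rat) :=
  if s is v :: s' then
    let! d := pair_diamT u v in
    let! m := (if acc is Some x then minT x d else ret d) in
    min_rowT u s' (Some m)
  else ret acc.

Fixpoint min_pairsT (s : seq qtraj) (acc : option rat) : timed (option rat) :=
  if s is u :: s' then
    let! acc' := min_rowT u s' acc in min_pairsT s' acc'
  else ret acc.

Definition min_pair_diamT (s : seq qtraj) : timed rat :=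
  let! m := min_pairsT s None in ret (odflt 0 m).

(* Whether u is to the left of v, with the tie-breaking rule at time 1. *)
Definition lefterT (u v : qtraj) : timed bool :=
  let! lt := ltT u.1 v.1 in
  if lt then ret true else
  let! gt := ltT v.1 u.1 in
  if gt then ret false else
  let! u1 := posT u 1 in
  let! v1 := posT v 1 in
  leT u1 v1.

Fixpoint leftmostT (s : qtraj) (S : seq qtraj) : timed qtraj :=
  if S is u :: S' then
    let! c := lefterT u s in leftmostT (if c then u else s) S'
  else ret s.

Fixpoint splitT (D : rat) (s : qtraj) (S : seq qtraj) :
    timed (seq qtraj * seq qtraj) :=
  if S is u :: S' then
    let! d := pair_diamT s u in
    let! c := leT d D in
    let! p := splitT D s S' in
    ret (if c then (u :: p.1, p.2) else (p.1, u :: p.2))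
  else ret ([::], [::]).

Fixpoint greedy_recT (depth : nat) (S : seq qtraj) (D : rat) :
    timed (seq (seq qtraj)) :=
  if depth is depth'.+1 then
    if S is u :: S' then
      let! s := leftmostT u S' in
      let! p := splitT D s S in
      let! r := greedy_recT depth' p.2 D in
      ret (p.1 :: r)
    else ret [::]
  else ret [::].

Definition GreedyPartitionT (S : seq qtraj) (D : rat) :
    timed (seq (seq qtraj)) := greedy_recT (size S) S D.

Inductive WhileT (St : Type) (test : St -> timed bool) (body : St -> timed St) :
    St -> timed St -> Prop :=
| WhileT_stop st : (test st).1 = false -> WhileT test body st (st, (test st).2)
| WhileT_step st st' n :
    (test st).1 = true -> WhileT test body (body st).1 (st', n) ->
    WhileT test body st (st', ((test st).2 + (body st).2 + n).+1).

Definition bs_stateT : Type := (rat * rat * option (seq (seq qtraj)))%type.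

Definition bs_testT (R : realType) (c : R) (m : rat) (st : bs_stateT) :
    timed bool :=
  let: (a, b, _) := st in
  let! w := subT b a in
  gt_multipleT c m w.

Definition bs_bodyT (S : seq qtraj) (k : nat) (st : bs_stateT) :
    timed bs_stateT :=
  let: (a, b, _) := st in
  let! ab := addT a b in
  let! D := divT ab 2 in
  let! G := GreedyPartitionT S D in
  let! c := longerT G k in
  ret (if c then (D, b, Some G) else (a, D, Some G)).

Definition bs_returnT (S : seq qtraj) (k : nat) (st : bs_stateT) :
    timed (seq (seq qtraj)) :=
  let: (_, b, last) := st in
  if last is Some G then
    let! c := longerT G k in
    if c then GreedyPartitionT S b else ret G
  else GreedyPartitionT S b.

(* The implementation terminates on (S, k), returns CC and takes T steps. *)
Definition kclusteringBS_runs (R : realType) (eps : R) (S : seq qtraj)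
    (k : nat) (CC : seq (seq qtraj)) (T : nat) : Prop :=
  let m := min_pair_diamT S in
  let b := diamT S in
  exists2 r : timed bs_stateT,
    WhileT (bs_testT (delta_coef eps) m.1) (bs_bodyT S k) (0, b.1, None) r
    & let out := bs_returnT S k r.1 in
      CC = out.1 /\ T = (m.2 + b.2 + r.2 + out.2)%N.

Definition real_traj (R : realType) (u : qtraj) : traj R :=
  (ratr u.1, ratr u.2).
Definition real_cluster (R : realType) (s : seq qtraj) : {fset traj R} :=
  [fset real_traj R u | u in s]%fset.

(* Main.v *)
(* Relative to the leftmost trajectory s of a greedy cluster, every trajectory of the
   cluster is an affine function f with f(0) >= 0 and int |f| <= D, whence
   0 <= f(0) <= (1 + sqrt 2) D, |f(1/2)| <= D and - (1 + sqrt 2) D <= f(1) <= 2 D.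
   The width of the cluster is convex, so its integral is at most that of the two chords
   over [0, 1/2] and [1/2, 1], which is (4 + sqrt 2) / 2 D.  If D is at least md of some
   k-clustering, each greedy cluster swallows what is left of an optimal cluster, so
   there are at most k of them.  Hence the left end a of the search interval never
   exceeds md^*, and delta is chosen so that the final gap b - a costs at most
   eps times the smallest distance of a pair, which is at most md^* when k < |S|.

   For the running time, sizes of rationals are measured by a height which is
   subadditive under the field operations; the ends of the search interval are
   consecutive multiples of diam S / 2^j after j steps, and the number of steps is
   logarithmic in diam S / delta. *)

Require Import Defs.
From mathcomp Require Import all_boot all_order all_algebra finmap.
From mathcomp Require Import all_classical all_reals all_analysis.
From mathcomp Require Import zify ring lra.
Import Order.TTheory GRing.Theory Num.Theory numFieldNormedType.Exports.
Set Implicit Arguments.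
Unset Strict Implicit.
Unset Printing Implicit Defensive.
Local Open Scope classical_set_scope.
Local Open Scope ring_scope.

(** * Integrals of piecewise affine functions and widths *)

Section Integrals.
Variable R : realType.
Notation mu := (@lebesgue_measure R).
Implicit Types (f g : R -> R) (a b c : R).

(** The number of greedy clusters is not known to be monotone in [D], so the search need not close
    in on [md_star], and nothing places the right end [b] above it. Two one-sided facts suffice: [a]
    stays at most [md_star S k], and the greedy partition at [b] has at most [k] clusters. When [k]
    is the cardinal of [S] the optimum is 0, which forces [a] to be 0, and the argument changes: the
    final [b] must lie below every pair distance, so that all greedy clusters are singletons. The
    loop of the rational program is run in lockstep with the abstract loop, [ratr] carrying each
    state to its real counterpart. A single induction then gives termination, the cost, and the
    equality of the two final states. *)

Lemma continuous_integrable_itv f a b :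
  continuous f -> mu.-integrable `[a, b] (EFin \o f).
Proof.
move=> cf; apply: continuous_compact_integrable; first exact: segment_compact.
by apply: continuous_subspaceT.
Qed.

Lemma continuous_affine (p q : R) : continuous (fun t : R => p + q * t).
Proof.
move=> t; apply: cvgD; first exact: cvg_cst.
by apply: cvgMr; exact: cvg_id.
Qed.

Lemma Rintegral_itv_split f a c b : continuous f -> a <= c -> c <= b ->
  \int[mu]_(t in `[a, b]) f t =
  \int[mu]_(t in `[a, c]) f t + \int[mu]_(t in `[c, b]) f t.
Proof.
move=> cf ac cb; apply/eqP; rewrite addrC -subr_eq; apply/eqP.
rewrite Rintegral_itvB ?bnd_simp//; last exact: continuous_integrable_itv.
rewrite Rintegral_itv_obnd_cbnd//.
by apply: integrableS (continuous_integrable_itv a b cf) => //;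
  apply: subset_itvr; rewrite bnd_simp.
Qed.

Lemma Rintegral_affine (p q a b : R) : a <= b ->
  \int[mu]_(t in `[a, b]) (p + q * t) = (b - a) * (p + q * a + (p + q * b)) / 2.
Proof.
rewrite le_eqVlt => /orP[/eqP <-|ab].
  by rewrite set_itv1 Rintegral_set1 subrr !mul0r.
pose F (t : R) : R := p * t + q / 2 * t ^+ 2.
have dF (t : R) : is_derive t 1 F (p + q * t).
  rewrite /F; apply: is_derive_eq.
  rewrite /GRing.scale /=. by field.
have cF : continuous F.
  by move=> t; apply/differentiable_continuous/derivable1_diffP; case: (dF t).
rewrite /Rintegral (@continuous_FTC2 _ _ F) //.
- by rewrite /F /=; field.
- by apply: continuous_subspaceT; exact: continuous_affine.
- split; first by move=> t _; case: (dF t).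
    exact/cvg_at_right_filter/cF.
  exact/cvg_at_left_filter/cF.
- by move=> t _; rewrite derive1E; case: (dF t).
Qed.

Lemma le_Rintegral_trapezoid f a b (p q : R) : continuous f -> a < b ->
  (forall t, a <= t <= b -> f t <= p + (q - p) / (b - a) * (t - a)) ->
  \int[mu]_(t in `[a, b]) f t <= (b - a) * (p + q) / 2.
Proof.
move=> cf ab fle; set m := (q - p) / (b - a) in fle.
have -> : (b - a) * (p + q) / 2 =
    \int[mu]_(t in `[a, b]) (p - m * a + m * t).
  rewrite Rintegral_affine ?ltW // /m; field.
  by rewrite subr_eq0 gt_eqF.
apply: le_Rintegral => //; first exact: continuous_integrable_itv.
  by apply: continuous_integrable_itv; exact: continuous_affine.
move=> t /=; rewrite in_itv /= => /fle; rewrite (_ : p + _ = p - m * a + m * t) //.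
by ring.
Qed.

(** The result mentions only the end values, which is what [sweepT] computes; the coefficients of an
    affine piece are merely known to exist. *)
Lemma Rintegral_trapezoid f a b (p q : R) : a <= b ->
  (forall t, a <= t <= b -> f t = p + q * t) ->
  \int[mu]_(t in `[a, b]) f t = (b - a) * (f a + f b) / 2.
Proof.
move=> ab fE; rewrite !fE ?lexx ?ab //.
rewrite -Rintegral_affine //; apply: eq_Rintegral => t.
by rewrite inE /= in_itv /= => /fE.
Qed.

End Integrals.

(** * Convexity, continuity and piecewise affinity of the width *)

Section Width.
Variable R : realType.
Notation mu := (@lebesgue_measure R).
Implicit Types (i j l s u v : traj R) (C S : {fset traj R}).

Lemma seq_argmax (T : eqType) (f : T -> R) (s : seq T) (x0 : T) :
  x0 \in s -> exists2 x, x \in s & forall y, y \in s -> f y <= f x.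
Proof.
elim: s x0 => // x s IH x0 _.
have [->|[y ys]] : s = [::] \/ exists y, y \in s.
- by case: s {IH} => [|y s]; [left|right; exists y; rewrite mem_head].
- by exists x; rewrite ?mem_head // => y; rewrite inE => /eqP ->.
have [z zs zmax] := IH _ ys.
have [fzx|fxz] := leP (f z) (f x).
  exists x; rewrite ?mem_head // => w; rewrite inE => /orP[/eqP -> //|/zmax].
  by move=> /le_trans; apply.
exists z; rewrite ?inE ?zs ?orbT // => w; rewrite inE => /orP[/eqP ->|/zmax //].
exact: ltW.
Qed.

(** Witnesses for the maximum and the minimum at time [t]: they replace the [sup] and [inf] of
    [width] by a difference of two affine functions. *)
Definition extremal C (t : R) i j :=
  [/\ i \in C, j \in C & forall l, l \in C -> pos j t <= pos l t <= pos i t].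

Lemma width_extremal C t i j : extremal C t i j -> width C t = pos i t - pos j t.
Proof.
move=> [iC jC ext]; rewrite /width.
have memC l : l \in C -> [set pos i t | i in [set` C]] (pos l t) by exists l.
congr (_ - _); apply/eqP; rewrite eq_le; apply/andP; split.
- by apply: ge_sup; [exists (pos i t); exact: memC|
    move=> _ [l lC <-]; case/andP: (ext _ lC)].
- apply: ub_le_sup (memC _ iC); exists (pos i t) => _ [l lC <-].
  by case/andP: (ext _ lC).
- apply: ge_inf (memC _ jC); exists (pos j t) => _ [l lC <-].
  by case/andP: (ext _ lC).
- by apply: lb_le_inf; [exists (pos j t); exact: memC|
    move=> _ [l lC <-]; case/andP: (ext _ lC)].
Qed.

Lemma extremal_exists C t : C != fset0 -> exists i j, extremal C t i j.
Proof.
case/fset0Pn => x xC.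
have [i iC imax] := seq_argmax (fun l => pos l t) xC.
have [j jC jmin] := seq_argmax (fun l => - pos l t) xC.
exists i, j; split=> // l lC; rewrite imax // andbT.
by rewrite -lerN2 jmin.
Qed.

Lemma pos_le_width C t u v : u \in C -> v \in C -> pos u t - pos v t <= width C t.
Proof.
move=> uC vC; have /(extremal_exists t)[i [j e]] : C != fset0.
  by apply/fset0Pn; exists u.
rewrite (width_extremal e); case: e => _ _ e.
have /andP[_ ?] := e _ uC; have /andP[? _] := e _ vC; lra.
Qed.

Lemma width_ge0 C t : C != fset0 -> 0 <= width C t.
Proof.
by case/fset0Pn => x xC; have := pos_le_width t xC xC; rewrite subrr.
Qed.

Lemma width_subset C C' t : C != fset0 -> (C `<=` C')%fset -> width C t <= width C' t.
Proof.
move=> /(extremal_exists t)[i [j e]] /fsubsetP sub.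
rewrite (width_extremal e); case: e => iC jC _.
by apply: pos_le_width; apply: sub.
Qed.

(** The pair extremal at [t] is compared with the width at [t']; each of its members moves at most
    at the largest speed in [C], whence the factor 2. Only continuity is drawn from this. *)
Lemma width_lipschitz C : C != fset0 ->
  exists2 V, 0 <= V & forall t t', width C t <= width C t' + V * `|t - t'|.
Proof.
move=> C0; case/fset0Pn: (C0) => x xC.
have [m mC mmax] := seq_argmax (fun l => `|l.2|) xC.
exists (2 * `|m.2|) => [|t t']; first by rewrite mulr_ge0.
have [i [j e]] := extremal_exists t C0.
rewrite (width_extremal e); case: e => iC jC _.
have := pos_le_width t' iC jC; rewrite /pos => h.
have hi : i.2 * (t - t') <= `|m.2| * `|t - t'|.
  by rewrite (le_trans (ler_norm _)) // normrM ler_wpM2r // mmax.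
have hj : - (j.2 * (t - t')) <= `|m.2| * `|t - t'|.
  by rewrite (le_trans (ler_norm _)) // normrN normrM ler_wpM2r // mmax.
lra.
Qed.

Lemma width_continuous C : C != fset0 -> continuous (width C).
Proof.
move=> /width_lipschitz[V V0 lip] t.
(* [V] may vanish, hence the division by [V + 1]. *)
have V1 : 0 < V + 1 by lra.
apply/cvgrPdist_lt => e e0; near=> t'.
have d : `|t - t'| < e / (V + 1).
  by near: t'; apply: cvgr_dist_lt => //; rewrite divr_gt0.
have {}d : (V + 1) * `|t - t'| < e by rewrite mulrC -ltr_pdivlMr.
have := lip t t'; have := lip t' t; rewrite distrC.
move=> h1 h2; rewrite ltr_distl.
have := normr_ge0 (t - t'); move: h1 h2 d; set n := `|t - t'| => h1 h2 d n0.
by apply/andP; split; lra.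
Unshelve. all: by end_near. Qed.

(** The difference of the pair extremal at [t] is affine, equals the width at [t], and is at most
    the width at [a] and at [b]. *)
Lemma width_convex C a b t : C != fset0 -> a < b -> a <= t <= b ->
  width C t <= width C a + (width C b - width C a) / (b - a) * (t - a).
Proof.
move=> C0 ab /andP[at_ tb].
have [i [j e]] := extremal_exists t C0.
rewrite (width_extremal e); case: e => iC jC _.
have ha := pos_le_width a iC jC; have hb := pos_le_width b iC jC.
have ba : 0 < b - a by rewrite subr_gt0.
rewrite -(ler_pM2r ba) [leRHS]mulrDl (mulrAC _ (t - a)) divfK ?gt_eqF //.
have := ler_wpM2r (_ : 0 <= b - t) ha; have := ler_wpM2r (_ : 0 <= t - a) hb.
rewrite !subr_ge0 /pos => /(_ at_) h1 /(_ tb) h2.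
by lra.
Qed.

Lemma diamE C : C != fset0 -> diam C = \int[mu]_(t in `[0, 1]) width C t.
Proof. by rewrite /diam => /negPf ->. Qed.

Lemma diam_ge0 C : 0 <= diam C.
Proof.
have [->|C0] := eqVneq C fset0; first by rewrite /diam eqxx.
by rewrite diamE // Rintegral_ge0 // => t _; apply: width_ge0.
Qed.

Lemma diam_subset C C' : (C `<=` C')%fset -> diam C <= diam C'.
Proof.
move=> sub; have [->|C0] := eqVneq C fset0; first by rewrite {1}/diam eqxx diam_ge0.
have C'0 : C' != fset0.
  by case/fset0Pn: C0 => x xC; apply/fset0Pn; exists x; apply: (fsubsetP sub).
rewrite !diamE //; apply: le_Rintegral => //;
  try exact: continuous_integrable_itv (width_continuous _).
by move=> t _; apply: width_subset.
Qed.

(* Two trajectories cross at most once, hence at the midpoint of [a, b] the order of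
   the trajectories is that of the whole interval. *)
Lemma width_affine C a b : C != fset0 -> a <= b ->
  (forall u v t, u \in C -> v \in C -> a < t < b -> pos u t = pos v t ->
     u.2 = v.2) ->
  exists p q, forall t, a <= t <= b -> width C t = p + q * t.
Proof.
move=> C0 ab nocross.
have [i [j [iC jC e]]] := extremal_exists ((a + b) / 2) C0.
exists (i.1 - j.1), (i.2 - j.2) => t tab.
have [ab_eq|nab] := eqVneq a b.
  have -> : t = (a + b) / 2.
    by case/andP: tab; move: ab_eq => <- ? ?; apply/eqP; rewrite eq_le; apply/andP; split; lra.
  by rewrite (@width_extremal _ _ i j) // /pos; ring.
have {}ab : a < b by rewrite lt_neqAle nab.
suff key u v : u \in C -> v \in C ->
    pos v ((a + b) / 2) <= pos u ((a + b) / 2) -> pos v t <= pos u t.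
  rewrite (@width_extremal _ _ i j); first by rewrite /pos; ring.
  split=> // l lC; have /andP[? ?] := e _ lC.
  by rewrite !key.
move=> uC vC; set m := (a + b) / 2 => h.
have am : a < m by rewrite /m; lra.
have mb : m < b by rewrite /m; lra.
rewrite leNgt; apply/negP => h'.
have w0 : u.2 - v.2 != 0.
  apply/eqP => /subr0_eq w0; move: h h'; rewrite /pos w0 => h h'; lra.
pose x := (v.1 - u.1) / (u.2 - v.2).
have xE : (u.2 - v.2) * x = v.1 - u.1 by rewrite /x mulrC divfK.
have cross : pos u x = pos v x by rewrite /pos; lra.
case/andP: tab => at_ tb.
(* The crossing lies between [m], possibly included, and [t], excluded; as [m] is interior, [x] is
   interior even if [t] is an end point. *)
have xab : a < x < b.
  move: h h'; rewrite /pos => h h'.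
  have {}h : 0 <= (u.2 - v.2) * (m - x) by rewrite mulrBr xE; lra.
  have {}h' : (u.2 - v.2) * (t - x) < 0 by rewrite mulrBr xE; lra.
  case: (ltrgt0P (u.2 - v.2)) w0 => // w _.
    move: h h'; rewrite pmulr_rge0 // pmulr_rlt0 // => ? ?; apply/andP; split; lra.
  move: h h'; rewrite nmulr_rge0 // nmulr_rlt0 // => ? ?; apply/andP; split; lra.
by move/eqP: w0; apply; rewrite (nocross _ _ _ uC vC xab cross) subrr.
Qed.

End Width.

(** * Closed formula for a pair and the diameter of a greedy cluster *)

Section PairDiam.
Variable R : realType.
Notation mu := (@lebesgue_measure R).
Implicit Types (i j l s u v : traj R) (C S : {fset traj R}).

(** Generic in the field, so that the value computed over [rat] and the integral over [R] are
    instances of one formula. *)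
Definition pair_diam (F : realFieldType) (d0 dv : F) : F :=
  let d1 := d0 + dv in
  if 0 <= d0 * d1 then `|d0 + d1| / 2 else (d0 * d0 + d1 * d1) / (2 * `|dv|).

Lemma continuous_abs_affine (p q : R) : continuous (fun t : R => `|p + q * t|).
Proof. by move=> t; apply: cvg_norm; exact: continuous_affine. Qed.

Lemma Rintegral_abs_affine (p q : R) :
  \int[mu]_(t in `[0, 1]) `|p + q * t| = pair_diam p q.
Proof.
wlog p0 : p q / 0 <= p.
  move=> H; have [/H //|pn] := leP 0 p.
  have -> : pair_diam p q = pair_diam (- p) (- q).
    by rewrite /pair_diam -!opprD !mulrNN !normrN.
  rewrite -H; last by rewrite oppr_ge0 ltW.
  by apply: eq_Rintegral => t _; rewrite mulNr -opprD normrN.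
have cf := @continuous_abs_affine p q.
rewrite /pair_diam; case: ifPn => [same|].
  have [q0|q0] := leP 0 (p + q).
    rewrite (@Rintegral_trapezoid _ _ _ _ p q) //.
      by rewrite !mulr0 !mulr1 addr0 (ger0_norm p0) (ger0_norm q0) ger0_norm; lra.
    move=> t /andP[t0 t1]; rewrite ger0_norm //.
    have : 0 <= p * (1 - t) by rewrite mulr_ge0 // subr_ge0.
    have : 0 <= (p + q) * t by rewrite mulr_ge0.
    lra.
  have {p0 same} p0 : p = 0.
    apply/eqP; rewrite eq_le p0 andbT leNgt; apply/negP => p0'.
    by move: same; rewrite pmulr_rge0 // leNgt q0.
  subst p; rewrite (@Rintegral_trapezoid _ _ _ _ 0 (- q)) //.
    by rewrite !mulr0 !mulr1 !add0r normr0; lra.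
  move=> t /andP[t0 t1]; rewrite !add0r in q0 *; rewrite ler0_norm ?mulNr //.
  by rewrite mulr_le0_ge0 // ltW.
rewrite -ltNge => opp.
have {}p0 : 0 < p.
  by rewrite lt_neqAle p0 andbT; apply: contraTneq opp => <-; rewrite mul0r ltxx.
have q0 : p + q < 0 by move: opp; rewrite pmulr_rlt0.
have qn : q < 0 by lra.
have q_neq0 : q != 0 by rewrite lt_eqF.
(* The zero of the function, where the two triangles meet. *)
pose c := p / - q.
have qc : p + q * c = 0 by rewrite /c; field.
have c0 : 0 <= c by rewrite divr_ge0 //; lra.
have c1 : c <= 1 by rewrite ler_pdivrMr; lra.
rewrite (Rintegral_itv_split cf c0 c1).
rewrite (@Rintegral_trapezoid _ _ 0 c p q) //; last first.
  move=> t /andP[t0 tc]; rewrite ger0_norm //.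
  have : q * c <= q * t by rewrite ler_nM2l.
  lra.
rewrite (@Rintegral_trapezoid _ _ c 1 (- p) (- q)) //; last first.
  move=> t /andP[ct t1]; rewrite ler0_norm ?opprD ?mulNr //.
  have : q * t <= q * c by rewrite ler_nM2l.
  lra.
rewrite qc normr0 mulr0 mulr1 !addr0 (gtr0_norm p0) (ltr0_norm q0) (ltr0_norm qn).
by rewrite /c; field.
Qed.

Lemma fset2_neq0 u v : [fset u; v]%fset != fset0 :> {fset traj R}.
Proof. by apply/fset0Pn; exists u; rewrite !inE eqxx. Qed.

Lemma width_pair u v (t : R) :
  width [fset u; v]%fset t = `|u.1 - v.1 + (u.2 - v.2) * t|.
Proof.
have -> : u.1 - v.1 + (u.2 - v.2) * t = pos u t - pos v t by rewrite /pos; ring.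
have [h|/ltW h] := lerP (pos v t) (pos u t).
  rewrite (@width_extremal _ _ _ u v) ?ger0_norm ?subr_ge0 //.
  split; rewrite ?inE ?eqxx ?orbT // => l; rewrite !inE => /orP[]/eqP ->;
    by rewrite ?lexx ?h.
rewrite (@width_extremal _ _ _ v u) ?ler0_norm ?subr_le0 ?opprB //.
split; rewrite ?inE ?eqxx ?orbT // => l; rewrite !inE => /orP[]/eqP ->;
  by rewrite ?lexx ?h.
Qed.

Lemma diam_pair u v : diam [fset u; v]%fset = pair_diam (u.1 - v.1) (u.2 - v.2).
Proof.
rewrite diamE ?fset2_neq0 // -Rintegral_abs_affine.
by apply: eq_Rintegral => t _; rewrite width_pair.
Qed.

Lemma diam_pairC u v : diam [fset u; v]%fset = diam [fset v; u]%fset :> R.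
Proof. by rewrite fsetUC. Qed.

Lemma diam_pairxx u : diam [fset u; u]%fset = 0 :> R.
Proof. by rewrite diam_pair /pair_diam !subrr addr0 mulr0 lexx addr0 normr0 mul0r. Qed.

Lemma diam_pair_gt0 u v : u <> v -> 0 < diam [fset u; v]%fset :> R.
Proof.
move=> uv; rewrite lt_neqAle diam_ge0 andbT; apply/eqP => /esym d0; apply: uv.
suff [h1 h2] : u.1 - v.1 = 0 /\ u.2 - v.2 = 0.
  by rewrite [u]surjective_pairing [v]surjective_pairing (subr0_eq h1) (subr0_eq h2).
move: d0; rewrite diam_pair /pair_diam; set p := u.1 - v.1; set q := u.2 - v.2.
case: ifPn => same.
  move=> /eqP; rewrite mulf_eq0 invr_eq0 pnatr_eq0 orbF normr_eq0 => /eqP h.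
  have p0 : p = 0.
    apply/eqP; rewrite -sqrf_eq0 expr2 eq_le -expr2 sqr_ge0 andbT.
    (* By [h] the end values are opposite, so their product, nonnegative by [same], is minus a
       square. *)
    have -> : p ^+ 2 = - (p * (p + q)) by rewrite -mulrN; congr (_ * _); lra.
    by rewrite oppr_le0.
  by split=> //; rewrite p0 in h; lra.
rewrite -ltNge in same.
have q0 : q != 0.
  by apply: contraTneq same => ->; rewrite addr0 -leNgt -expr2 sqr_ge0.
move=> /eqP; rewrite mulf_eq0 invr_eq0 mulf_eq0 normr_eq0 (negPf q0) pnatr_eq0 !orbF.
rewrite -!expr2 paddr_eq0 ?sqr_ge0 // !sqrf_eq0 => /andP[/eqP p0 /eqP].
by rewrite p0 add0r.
Qed.

Lemma diam1 u : diam [fset u]%fset = 0 :> R.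
Proof. by rewrite -[RHS](diam_pairxx u) fsetUid. Qed.

(** The mean of an affine function over [0, 1] is its midpoint value, and the absolute value of an
    integral is at most the integral of the absolute value. *)
Lemma half_le_diam_pair s u (D : R) : diam [fset s; u]%fset <= D ->
  `|pos u (1 / 2) - pos s (1 / 2)| <= D.
Proof.
apply: le_trans; rewrite diam_pairC diam_pair -Rintegral_abs_affine.
have h := le_normr_Rintegral (mu := mu) (measurable_itv `[0, 1])
  (continuous_integrable_itv 0 1 (@continuous_affine R (u.1 - s.1) (u.2 - s.2))).
apply: le_trans h; rewrite Rintegral_affine //.
by rewrite le_eqVlt; apply/orP; left; apply/eqP; congr `|_|; rewrite /pos; field.
Qed.

(* When p and p + q have opposite signs, [pair_diam p q <= D] is a disc of radius
   sqrt 2 D around (D, D) for the pair (p, - (p + q)). *)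
Lemma pair_diam_endpoints (p q D : R) : 0 <= p -> pair_diam p q <= D ->
  [/\ p <= (1 + Num.sqrt 2) * D, p + q <= 2 * D & - (1 + Num.sqrt 2) * D <= p + q].
Proof.
move=> p0; rewrite /pair_diam; set r := p + q.
have w2 : Num.sqrt 2 * Num.sqrt 2 = 2 :> R by rewrite -expr2 sqr_sqrtr.
have w1 : 1 <= Num.sqrt 2 :> R by rewrite -{1}sqrtr1 ler_wsqrtr // ler1n.
set w : R := Num.sqrt 2 in w1 w2 *; case: ifPn => [same|].
  rewrite ler_pdivrMr // => h.
  have D0 : 0 <= D by have := normr_ge0 (p + r); lra.
  have w1D : 0 <= (w - 1) * D by rewrite mulr_ge0 // subr_ge0.
  have hr := le_trans (ler_norm _) h.
  have hl : - (D * 2) <= p + r by move: h; rewrite ler_norml => /andP[].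
  have [r0|r0] := leP 0 r; first by split; lra.
  suff pz : p = 0 by split; lra.
  apply/eqP; rewrite eq_le p0 andbT leNgt; apply/negP => p0'.
  by move: same; rewrite pmulr_rge0 // leNgt r0.
rewrite -ltNge => opp.
have {}p0 : 0 < p.
  by rewrite lt_neqAle p0 andbT; apply: contraTneq opp => <-; rewrite mul0r ltxx.
have r0 : r < 0 by move: opp; rewrite pmulr_rlt0.
have qn : q < 0 by rewrite /r in r0; lra.
have qE : q = r - p by rewrite /r; ring.
rewrite ltr0_norm // ler_pdivrMr; last by lra.
rewrite qE => h.
have D0 : 0 <= D.
  rewrite leNgt; apply/negP => Dn.
  have : D * (2 * - (r - p)) < 0 by rewrite nmulr_rlt0 //; lra.
  have := sqr_ge0 p; have := sqr_ge0 r; rewrite !expr2; lra.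
have wD : 0 <= w * D by rewrite mulr_ge0 //; lra.
have disc : (p - D) * (p - D) + (r + D) * (r + D) <= (w * D) * (w * D).
  have -> : w * D * (w * D) = 2 * (D * D) by rewrite -w2; ring.
  lra.
have sq (x : R) : x * x <= w * D * (w * D) -> x <= w * D.
  move=> hx; rewrite leNgt; apply/negP => lt.
  by have := ltr_pM wD wD lt lt; rewrite ltNge hx.
have := sqr_ge0 (p - D); have := sqr_ge0 (r + D); rewrite !expr2 => a1 a2.
have b1 : p - D <= w * D by apply: sq; lra.
have b2 : - (r + D) <= w * D by apply: sq; rewrite mulrNN; lra.
by split; lra.
Qed.

(* The width is convex, so on [0, 1/2] and on [1/2, 1] it lies below its chord; the
   endpoint bounds are (1 + sqrt 2) D, 2 D and (3 + sqrt 2) D. *)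
Lemma diam_le_of_leftmost C s (D : R) : C != fset0 ->
  (forall u, u \in C -> pos s 0 <= pos u 0) ->
  (forall u, u \in C -> diam [fset s; u]%fset <= D) ->
  diam C <= (4 + Num.sqrt 2) / 2 * D.
Proof.
move=> C0 right near.
have cw := width_continuous C0.
have h0 : (0 : R) <= 1 / 2 by lra.
have h1 : 1 / 2 <= 1 :> R by lra.
have h0' : (0 : R) < 1 / 2 by lra.
have h1' : 1 / 2 < 1 :> R by lra.
rewrite diamE // (Rintegral_itv_split cw h0 h1).
have i1 := le_Rintegral_trapezoid cw h0' (fun t => width_convex C0 h0').
have i2 := le_Rintegral_trapezoid cw h1' (fun t => width_convex C0 h1').
have ends u : u \in C -> [/\ pos s 0 <= pos u 0,
    pos u 0 - pos s 0 <= (1 + Num.sqrt 2) * D,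
    pos u 1 - pos s 1 <= 2 * D & - (1 + Num.sqrt 2) * D <= pos u 1 - pos s 1].
  move=> uC; have hu := right _ uC.
  have := near _ uC; rewrite diam_pairC diam_pair => hd.
  have p0 : 0 <= u.1 - s.1 by move: hu; rewrite /pos !mulr0 !addr0 subr_ge0.
  have [a b c] := pair_diam_endpoints p0 hd.
  by split=> //; rewrite /pos !(mulr0, mulr1, addr0); lra.
have w0 : width C 0 <= (1 + Num.sqrt 2) * D.
  have [i [j e]] := extremal_exists 0 C0; rewrite (width_extremal e).
  by case: e => /ends[? ? _ _] /ends[? ? _ _] _; lra.
have w1 : width C 1 <= (3 + Num.sqrt 2) * D.
  have [i [j e]] := extremal_exists 1 C0; rewrite (width_extremal e).
  by case: e => /ends[_ _ ? ?] /ends[_ _ ? ?] _; lra.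
have wh : width C (1 / 2) <= 2 * D.
  have [i [j e]] := extremal_exists (1 / 2) C0; rewrite (width_extremal e).
  case: e => /near/half_le_diam_pair + /near/half_le_diam_pair + _.
  by rewrite !ler_norml => /andP[? ?] /andP[? ?]; lra.
(* The two trapezoids add up to (w0 + 2 wh + w1) / 4, and (1 + sqrt 2) + 4 + (3 + sqrt 2) is four
   times (4 + sqrt 2) / 2. *)
lra.
Qed.

End PairDiam.

(** * Greedy clusters and the binary search *)

Section Greedy.
Variable R : realType.
Implicit Types (s u v : traj R) (C S : {fset traj R}) (CC : seq {fset traj R}) (D : R).

Lemma le_md C CC : C \in CC -> diam C <= md CC.
Proof.
rewrite /md; elim: CC => // C' CC IH; rewrite inE big_cons le_max => /orP[/eqP <-|/IH ->].
  by rewrite lexx.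
by rewrite orbT.
Qed.

Lemma md_le CC D : 0 <= D -> (forall C, C \in CC -> diam C <= D) -> md CC <= D.
Proof.
move=> D0; rewrite /md; elim: CC => [|C' CC IH] h; first by rewrite big_nil.
rewrite big_cons ge_max h ?mem_head // IH // => C CCC.
by apply: h; rewrite inE CCC orbT.
Qed.

Lemma md_ge0 CC : 0 <= md CC.
Proof. by rewrite /md; elim: CC => [|C CC IH]; rewrite ?big_nil // big_cons le_max IH orbT. Qed.

Lemma is_leftmost_exists S : S != fset0 -> exists s, is_leftmost S s.
Proof.
case/fset0Pn => x xS.
have [y yS ymin] := seq_argmax (fun l => - pos l 0) xS.
have yS' : y \in [fset z in S | pos z 0 == pos y 0]%fset by rewrite !inE yS eqxx.
have [z zS zmin] := seq_argmax (fun l => - pos l 1) yS'.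
move: zS; rewrite !inE => /andP[zS /eqP zy].
exists z; split=> // u uS; rewrite zy.
have := ymin _ uS; rewrite lerN2 le_eqVlt => /orP[/eqP h|]; last by left.
right; split=> //; rewrite -lerN2; apply: zmin.
by rewrite !inE uS h eqxx.
Qed.

(** Positions at times 0 and 1 determine a trajectory, so the tie-break leaves no tie. *)
Lemma is_leftmost_unique S s u : is_leftmost S s -> is_leftmost S u -> s = u.
Proof.
move=> [sS hs] [uS hu]; move: (hs _ uS) (hu _ sS) => {hs hu}.
rewrite [s]surjective_pairing [u]surjective_pairing /pos /=.
case=> [h1|[h1 h2]] [h3|[h3 h4]]; try by exfalso; lra.
by congr (_, _); lra.
Qed.

Lemma leftmostP S : S != fset0 -> is_leftmost S (leftmost S).
Proof. by move=> /is_leftmost_exists; exact: xgetPex. Qed.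

Lemma leftmost_eq S s : is_leftmost S s -> leftmost S = s.
Proof.
move=> h; apply: is_leftmost_unique (h); apply: leftmostP.
by apply/fset0Pn; exists s; case: h.
Qed.

Definition greedy_cluster S D : {fset traj R} :=
  [fset s' in S | diam [fset leftmost S; s']%fset <= D]%fset.

Lemma greedy_recS n S D : greedy_rec n.+1 S D =
  if S == fset0 then [::]
  else greedy_cluster S D :: greedy_rec n (S `\` greedy_cluster S D)%fset D.
Proof. by []. Qed.

Lemma mem_greedy_cluster S D u :
  (u \in greedy_cluster S D) = (u \in S) && (diam [fset leftmost S; u]%fset <= D).
Proof. by rewrite !inE. Qed.

Lemma greedy_cluster_sub S D : (greedy_cluster S D `<=` S)%fset.
Proof. by apply/fsubsetP => u; rewrite mem_greedy_cluster => /andP[]. Qed.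

Lemma leftmost_in_cluster S D : S != fset0 -> 0 <= D -> leftmost S \in greedy_cluster S D.
Proof.
by move=> /leftmostP[lS _] D0; rewrite mem_greedy_cluster lS diam_pairxx.
Qed.

Lemma greedy_rec_sub n S D C : C \in greedy_rec n S D -> (C `<=` S)%fset.
Proof.
elim: n S => // n IH S; rewrite greedy_recS; case: eqP => // _.
rewrite inE => /orP[/eqP ->|/IH h]; first exact: greedy_cluster_sub.
by apply: fsubset_trans h _; exact: fsubsetDl.
Qed.

Lemma greedy_rec_disjoint n S D :
  pairwise (fun C C' => [disjoint C & C']%fset) (greedy_rec n S D).
Proof.
elim: n S => // n IH S; rewrite greedy_recS; case: eqP => // _.
rewrite pairwise_cons IH andbT; apply/allP => C /greedy_rec_sub sub.
apply/fdisjointP => u uc; apply/negP => /(fsubsetP sub).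
by rewrite in_fsetD uc.
Qed.

Lemma greedy_rec_cover n S D : 0 <= D -> (#|` S| <= n)%N ->
  (\bigcup_(C <- greedy_rec n S D) C)%fset = S.
Proof.
move=> D0; elim: n S => [|n IH] S.
  by rewrite leqn0 => /eqP/cardfs0_eq ->; rewrite big_nil.
rewrite greedy_recS; case: eqP => [->|/eqP S0] hn; first by rewrite big_nil.
have sub := greedy_cluster_sub S D.
rewrite big_cons IH.
  by apply/fsetP => u; rewrite in_fsetU in_fsetD; case: (boolP (u \in _)) => // /(fsubsetP sub) ->.
rewrite cardfsDS // leq_subLR; apply: leq_trans hn _.
rewrite -addn1 addnC leq_add2r cardfs_gt0; apply/fset0Pn.
by exists (leftmost S); exact: leftmost_in_cluster.
Qed.

(** [CC] is only asked to cover [S], because this form survives the recursion: the member of [CC]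
    holding the leftmost trajectory lies within [D] of it, so the remainder of [S] is covered by
    [CC] without that member. *)
Lemma size_greedy_rec_le n S D CC :
  (forall u, u \in S -> exists2 C, C \in CC & u \in C) ->
  (forall C, C \in CC -> diam C <= D) -> (size (greedy_rec n S D) <= size CC)%N.
Proof.
elim: n S CC => // n IH S CC cover small; rewrite greedy_recS; case: eqP => // /eqP S0.
have [lS _] := leftmostP S0; have [C0 C0CC lC0] := cover _ lS.
have CC0 : (0 < size CC)%N by case: CC C0CC {cover small}.
rewrite /= -(prednK CC0) ltnS -(size_rem C0CC); apply: IH.
  move=> u; rewrite in_fsetD mem_greedy_cluster => /andP[+ uS]; rewrite uS /= => far.
  have [C CCC uC] := cover _ uS; exists C => //.
  move: CCC; rewrite (perm_mem (perm_to_rem C0CC)) inE => /orP[/eqP CE|//].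
  case/negP: far; apply: le_trans (small _ C0CC); apply: diam_subset.
  by apply/fsubsetP => x; rewrite !inE => /orP[]/eqP -> //; rewrite -CE.
by move=> C /mem_rem; exact: small.
Qed.

Lemma greedy_rec_diam n S D C : 0 <= D -> C \in greedy_rec n S D ->
  diam C <= (4 + Num.sqrt 2) / 2 * D.
Proof.
move=> D0; elim: n S => // n IH S; rewrite greedy_recS; case: eqP => // /eqP S0.
rewrite inE => /orP[/eqP ->|/IH //].
apply: (@diam_le_of_leftmost _ _ (leftmost S)).
- by apply/fset0Pn; exists (leftmost S); exact: leftmost_in_cluster.
- move=> u; rewrite mem_greedy_cluster => /andP[uS _].
  by case: (leftmostP S0) => _ /(_ _ uS)[/ltW//|[-> _]].
- by move=> u; rewrite mem_greedy_cluster => /andP[].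
Qed.

Lemma greedy_kclustering S D k : 0 <= D ->
  (size (GreedyPartition S D) <= k)%N -> kclustering S k (GreedyPartition S D).
Proof.
move=> D0 sz; split=> //; first exact: greedy_rec_disjoint.
exact: greedy_rec_cover.
Qed.

Lemma kclustering_mem S k CC u : kclustering S k CC -> u \in S ->
  exists2 C, C \in CC & u \in C.
Proof. by move=> [_ _ <-] /bigfcupP[C]; rewrite andbT; exists C. Qed.

Lemma kclustering_sub S k CC C : kclustering S k CC -> C \in CC -> {subset C <= S}.
Proof. by move=> [_ _ <-] CCC u uC; apply/bigfcupP; exists C; rewrite ?CCC. Qed.

Lemma size_greedy_le S k D CC : kclustering S k CC -> md CC <= D ->
  (size (GreedyPartition S D) <= k)%N.
Proof.
move=> kCC mdD; have [sz _ _] := kCC; apply: leq_trans sz.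
apply: size_greedy_rec_le => [u /(kclustering_mem kCC)//|C /le_md h].
exact: le_trans mdD.
Qed.

Lemma size_greedy_diam S : (size (GreedyPartition S (diam S)) <= 1)%N.
Proof.
apply: (@size_greedy_rec_le _ _ _ [:: S]) => [u uS|C].
  by exists S; rewrite ?inE.
by rewrite inE => /eqP ->.
Qed.

Lemma singletons_kclustering S : kclustering S #|` S| [seq [fset u]%fset | u <- S].
Proof.
split.
- by rewrite size_map.
- rewrite pairwise_map; have : uniq S by exact: fset_uniq.
  rewrite uniq_pairwise; apply: sub_pairwise => u v /= uv.
  by rewrite fdisjoint1X inE.
- rewrite big_map; apply/fsetP => u; apply/bigfcupP/idP => [[v]|uS].
    by rewrite andbT inE => vS /eqP ->.
  by exists u; rewrite ?uS ?inE.
Qed.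

Lemma md_singletons S : md [seq [fset u]%fset | u <- S] = 0.
Proof.
apply/eqP; rewrite eq_le md_ge0 andbT; apply: md_le => // C /mapP[u _ ->].
by rewrite diam1.
Qed.

Lemma single_kclustering S k : (0 < k)%N -> kclustering S k [:: S].
Proof. by move=> k0; split=> //; rewrite big_seq1. Qed.

Lemma le_md_star S k D : (0 < k)%N ->
  (forall CC, kclustering S k CC -> D <= md CC) -> D <= md_star S k.
Proof.
move=> k0 h; apply: lb_le_inf; last by move=> _ [CC /= kCC <-]; exact: h.
by exists (md [:: S]); exists [:: S] => //=; exact: single_kclustering.
Qed.

Lemma md_star_le S k CC : kclustering S k CC -> md_star S k <= md CC.
Proof.
move=> kCC; apply: ge_inf; last by exists CC.
by exists 0 => _ [CC' _ <-]; exact: md_ge0.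
Qed.

Lemma md_star_ge0 S k : (0 < k)%N -> 0 <= md_star S k.
Proof. by move=> k0; apply: le_md_star => // CC _; exact: md_ge0. Qed.

Lemma size_greedy_gt_md_star S k D : (0 < k)%N ->
  (k < size (GreedyPartition S D))%N -> D <= md_star S k.
Proof.
move=> k0 sz; apply: le_md_star => // CC kCC.
rewrite leNgt; apply/negP => /ltW /(size_greedy_le kCC).
by rewrite leqNgt sz.
Qed.

Lemma card_bigfcup_le CC : (#|` \bigcup_(C <- CC) C| <= \sum_(C <- CC) #|` C|)%fset%N.
Proof.
elim: CC => [|C CC IH]; first by rewrite !big_nil cardfs0.
by rewrite !big_cons (leq_trans (leq_card_fsetU _ _)) // leq_add2l.
Qed.

(** Pigeonhole: clusters with at most one member each would have a union of at most [k] elements. *)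
Lemma kclustering_pair S k CC : (k < #|` S|)%N -> kclustering S k CC ->
  exists C u v, [/\ C \in CC, u \in C, v \in C & u <> v].
Proof.
move=> kS kCC; have [sz _ cov] := kCC.
have : ~~ all (fun C : {fset traj R} => #|` C| <= 1)%N CC.
  apply/negP => /allP small; move: kS; apply/negP; rewrite -leqNgt.
  rewrite -cov (leq_trans (card_bigfcup_le _)) // (leq_trans _ sz) //.
  rewrite -sum1_size big_seq [leqRHS]big_seq; apply: leq_sum => C; exact: small.
rewrite -has_predC => /hasP[C CCC]; rewrite /= -ltnNge => C1.
have /fset0Pn[u uC] : C != fset0 by rewrite -cardfs_gt0 ltnW.
have /fset0Pn[v] : (C `\ u)%fset != fset0.
  by rewrite -cardfs_gt0; move: C1; rewrite (cardfsD1 u C) uC.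
rewrite !inE => /andP[vu vC]; exists C, u, v.
by split=> //; apply/eqP; rewrite eq_sym.
Qed.

Lemma inf_minimum (E : set R) m : E m -> (forall d, E d -> m <= d) -> inf E = m.
Proof.
move=> Em h; apply/eqP; rewrite eq_le; apply/andP; split.
  by apply: ge_inf => //; exists m.
by apply: lb_le_inf => //; exists m.
Qed.

Lemma min_pair_diam_le S u v : u \in S -> v \in S -> u <> v ->
  min_pair_diam S <= diam [fset u; v]%fset.
Proof.
move=> uS vS uv; apply: ge_inf; last by exists u, v.
by exists 0 => _ [u' [v' [_ _ _ ->]]]; exact: diam_ge0.
Qed.

(** Positivity of each pair distance does not bound the infimum away from 0; listing the finitely
    many pairs in [P] shows that it is attained. *)
Lemma min_pair_diam_gt0 S : (1 < #|` S|)%N -> 0 < min_pair_diam S.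
Proof.
move=> S1; pose P := [seq p <- allpairs pair S S | p.1 != p.2].
have PE (p : traj R * traj R) : p \in P = [&& p.1 \in S, p.2 \in S & p.1 != p.2].
  rewrite mem_filter andbC andbA; congr (_ && _); apply/allpairsP/andP.
    by case=> q [? ? ->].
  by case=> h1 h2; exists p; split=> //; case: p {h1 h2}.
have /fset0Pn[u uS] : S != fset0 by rewrite -cardfs_gt0 ltnW.
have /fset0Pn[v] : (S `\ u)%fset != fset0.
  by rewrite -cardfs_gt0; move: S1; rewrite (cardfsD1 u S) uS.
rewrite !inE => /andP[vu vS].
have uvP : (u, v) \in P by rewrite PE /= uS vS eq_sym.
have [[x y] xyP xymin] := seq_argmax (fun p => - diam [fset p.1; p.2]%fset) uvP.
move: xyP; rewrite PE => /= /and3P[xS yS /eqP xy].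
rewrite /min_pair_diam (@inf_minimum _ (diam [fset x; y]%fset)).
- exact: diam_pair_gt0.
- by exists x, y.
- move=> _ [u' [v' [u'S v'S /eqP uv' ->]]]; rewrite -lerN2.
  by apply: (xymin (u', v')); rewrite PE /= u'S v'S.
Qed.

(** The infimum of the empty set is 0. Equality of members, rather than a cardinal, is what the
    program's empty accumulator yields in [min_pair_diamT_val]. *)
Lemma min_pair_diam_trivial S : (forall u v, u \in S -> v \in S -> u = v) ->
  min_pair_diam S = 0.
Proof.
move=> eqS; rewrite /min_pair_diam -[RHS](inf0 R); congr inf.
by apply/seteqP; split=> // d [u [v [uS vS uv _]]]; case: uv; exact: eqS.
Qed.

Lemma min_pair_diam_small S : (#|` S| <= 1)%N -> min_pair_diam S = 0.
Proof.
move=> S1; apply: min_pair_diam_trivial => u v uS vS; apply/eqP; apply: contraLR S1 => uv.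
rewrite -ltnNge; have := cardfs2 u v; rewrite uv => <-; apply: fsubset_leq_card.
by apply/fsubsetP => x; rewrite !inE => /orP[]/eqP ->.
Qed.

Lemma min_pair_diam_le_md_star S k : (0 < k)%N -> (k < #|` S|)%N ->
  min_pair_diam S <= md_star S k.
Proof.
move=> k0 kS; apply: le_md_star => // CC kCC; move: (kclustering_pair kS kCC).
move=> [C [u [v [CCC uC vC uv]]]].
have sub := kclustering_sub kCC CCC; have [uS vS] := (sub _ uC, sub _ vC).
apply: le_trans (min_pair_diam_le uS vS uv) (le_trans _ (le_md CCC)).
by apply: diam_subset; apply/fsubsetP => x; rewrite !inE => /orP[]/eqP ->.
Qed.

Lemma card_small_diam S : (#|` S| <= 1)%N -> diam S = 0.
Proof.
have [->|/fset0Pn[u uS] S1] := eqVneq S fset0; first by rewrite /diam eqxx.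
suff -> : S = [fset u]%fset by exact: diam1.
apply/fsetP => v; rewrite inE; apply/idP/eqP => [vS|-> //].
apply/eqP; move: S1; rewrite (cardfsD1 u S) uS leq_add2l leqn0 cardfs_eq0 => /eqP.
by move/fsetP/(_ v); rewrite !inE vS andbT => /negbFE.
Qed.

Lemma greedy_rec_singletons n S D C : D < min_pair_diam S -> 0 <= D ->
  C \in greedy_rec n S D -> diam C = 0.
Proof.
move=> Dm D0.
(* The bound on [D] has to keep referring to the original [S]: once a single trajectory is left,
   [min_pair_diam] of the remainder is 0 and the hypothesis fails for it. *)
suff gen S' : (S' `<=` S)%fset -> C \in greedy_rec n S' D -> diam C = 0 by exact: gen.
elim: n S' => // n IH S' sub; rewrite greedy_recS; case: eqP => // /eqP S0.
rewrite inE => /orP[/eqP ->|/IH]; last first.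
  by apply; apply: fsubset_trans sub; exact: fsubsetDl.
have [lS _] := leftmostP S0.
suff -> : greedy_cluster S' D = [fset leftmost S']%fset by exact: diam1.
apply/fsetP => u; rewrite mem_greedy_cluster inE; apply/andP/eqP => [[uS uD]|->].
  apply/eqP; rewrite eq_sym; apply/negP => /negP/eqP ul.
  have := min_pair_diam_le (fsubsetP sub _ lS) (fsubsetP sub _ uS) ul.
  by rewrite leNgt (le_lt_trans uD).
by rewrite lS diam_pairxx.
Qed.

End Greedy.

(** * Termination and approximation ratio of the binary search *)

Section BinarySearch.
Variable R : realType.
Variables (eps : R) (S : {fset traj R}) (k : nat).
Hypotheses (eps0 : 0 < eps) (k0 : (0 < k)%N) (kS : (k <= #|` S|)%N).
Let delta := delta_coef eps * min_pair_diam S.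

(** The last clause makes every branch of [bs_return] yield the greedy partition at [b]: a stored
    clustering either is that partition or has too many clusters and is recomputed. *)
Definition bs_invariant (st : bs_state R) : Prop :=
  let: (a, b, last) := st in
  [/\ 0 <= a, a <= b, a <= md_star S k,
      (size (GreedyPartition S b) <= k)%N
    & forall G, last = Some G -> (k < size G)%N \/ G = GreedyPartition S b].

Lemma bs_invariant_init : bs_invariant (bs_init S).
Proof.
split=> //; [exact: diam_ge0|exact: md_star_ge0|].
exact: leq_trans (size_greedy_diam S) _.
Qed.

Lemma bs_invariant_body st : bs_invariant st -> bs_invariant (bs_body S k st).
Proof.
case: st => [[a b] last] [a0 ab am sb lastP] /=.
case: ltnP => [kG|Gk].
  split=> //; [lra|lra|exact: size_greedy_gt_md_star|].
  by move=> G [<-]; left.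
by split=> //; [lra|move=> G [<-]; right].
Qed.

Lemma delta_coef_gt0 : 0 < delta_coef eps.
Proof. by rewrite divr_gt0 ?mulr_gt0 // ltr_wpDr // sqrtr_ge0. Qed.

(** Induction on [m], a bound for the number of halvings left, stands in for a well-founded order on
    the reals. *)
Lemma bs_loop (m : nat) st : bs_invariant st -> st.1.2 - st.1.1 <= delta * 2 ^+ m ->
  exists st', [/\ While (bs_test eps S) (bs_body S k) st st', bs_invariant st'
    & st'.1.2 - st'.1.1 <= delta].
Proof.
elim: m st => [|m IH] st inv h.
  exists st; split=> //; last by rewrite mulr1 in h.
  by apply: While_stop; case: st h {inv} => [[a b] last] /=; rewrite mulr1 ltNge => ->.
have [t|t] := boolP (bs_test eps S st); last first.
  exists st; split=> //; first exact/While_stop/negbTE.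
  by case: st t {inv h} => [[a b] last] /=; rewrite -leNgt.
have [] := IH _ (bs_invariant_body inv).
  case: st h {inv t} => [[a b] last] /=; rewrite exprS.
  by case: ifP => _ /= h; lra.
by move=> st' [w inv' h']; exists st'; split=> //; exact: While_step.
Qed.

Lemma bs_terminates : exists st, [/\ While (bs_test eps S) (bs_body S k) (bs_init S) st,
  bs_invariant st & st.1.2 - st.1.1 <= delta].
Proof.
have [m hm] : exists m, diam S - 0 <= delta * 2 ^+ m.
  (* With a single trajectory [delta] is 0, but so is the initial gap, and the loop never starts. *)
  have [S1|S1] := leqP #|` S| 1.
    by exists 0%N; rewrite card_small_diam // /delta min_pair_diam_small // mulr0 mul0r subr0.
  have d0 : 0 < delta by rewrite mulr_gt0 ?delta_coef_gt0 ?min_pair_diam_gt0.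
  exists (Num.Def.truncn (diam S / delta)).+1.
  rewrite subr0 mulrC -ler_pdivrMr //.
  have q0 : 0 <= diam S / delta by rewrite divr_ge0 ?diam_ge0 ?ltW.
  apply: le_trans (ltW (truncnS_gt _)) _.
  by rewrite -natrX ler_nat ltnW // ltn_expl.
exact: bs_loop bs_invariant_init hm.
Qed.

Lemma bs_return_inv st : bs_invariant st -> bs_return S k st = GreedyPartition S st.1.2.
Proof.
case: st => [[a b] [G|]] [_ _ _ sb /= lastP] //.
by case: ltnP => // Gk; case: (lastP G) => //; rewrite ltnNge Gk.
Qed.

Lemma kclusteringBS_approx : exists CC, [/\ kclusteringBS eps S k CC, kclustering S k CC &
  (k = #|` S| -> (1 < #|` S|)%N -> eps < (4 + Num.sqrt 2) / 2) ->
  md CC <= ((4 + Num.sqrt 2) / 2 + eps) * md_star S k].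
Proof.
have [st [w inv h]] := bs_terminates.
exists (bs_return S k st); split; first by exists st.
  rewrite bs_return_inv //; case: st inv {w h} => [[a b] last] [a0 ab _ sb _].
  by apply: greedy_kclustering => //; exact: le_trans ab.
move=> heps; rewrite bs_return_inv //.
case: st inv h {w} => [[a b] last] [a0 ab am _ _] /= h.
have b0 : 0 <= b by exact: le_trans ab.
have ms0 := md_star_ge0 S k0.
have s0 : 0 <= Num.sqrt 2 :> R by exact: sqrtr_ge0.
set c := (4 + Num.sqrt 2) / 2 in heps *.
have c0 : 0 < c by rewrite divr_gt0 //; lra.
(* Hence [c * delta] is exactly [eps * min_pair_diam S], the loss allowed in the bound c b <= c (a +
   delta). *)
have coef : delta_coef eps = eps / c by rewrite /delta_coef /c; field; lra.
have [kn|kn] := ltnP k #|` S|.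
  have hm := min_pair_diam_le_md_star k0 kn.
  have : md (GreedyPartition S b) <= c * b.
    by apply: md_le => [|C]; [rewrite mulr_ge0 // ltW|exact: greedy_rec_diam].
  move=> /le_trans; apply; rewrite mulrDl.
  have : c * b <= c * (md_star S k + delta) by rewrite ler_pM2l //; lra.
  move=> /le_trans; apply; rewrite mulrDr lerD2l /delta coef.
  rewrite [leLHS](_ : _ = eps * min_pair_diam S) ?ler_pM2l //.
  by field; rewrite gt_eqF.
have {kn} kn : k = #|` S| by apply/eqP; rewrite eqn_leq kS.
(* Singletons are optimal, so [a] is 0 and [b <= delta]; the condition on [eps] puts [delta] below
   every pair distance. *)
have ms : md_star S k = 0.
  apply/eqP; rewrite eq_le ms0 andbT -(md_singletons S); apply: md_star_le.
  by rewrite kn; exact: singletons_kclustering.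
rewrite ms mulr0; apply: md_le => // C.
have [S1|S1] := leqP #|` S| 1.
  by move=> /greedy_rec_sub/diam_subset; rewrite (card_small_diam S1).
move=> CG; rewrite (greedy_rec_singletons _ b0 CG) //.
have mp := min_pair_diam_gt0 S1.
have : delta < min_pair_diam S.
  by rewrite /delta coef gtr_pMl // ltr_pdivrMr // mul1r heps.
by move: h; lra.
Qed.

End BinarySearch.

(** * Heights of rationals and cost of the implementation *)

Section Height.
Implicit Types x y : rat.

Lemma ltn_nbits n : (n < 2 ^ nbits n)%N.
Proof. exact: trunc_log_ltn. Qed.

Lemma exp2_gt1 h : (0 < h)%N -> (1 < 2 ^ h)%N.
Proof. by move=> h0; apply: leq_ltn_trans h0 _; exact: ltn_expl. Qed.

Lemma nbits_le n h : (0 < h)%N -> (n < 2 ^ h)%N -> (nbits n <= h)%N.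
Proof.
move=> h0 nh; have [->|n0] := posnP n; first by rewrite /nbits trunc_log0.
rewrite /nbits -(ltn_exp2l _ _ (isT : 1 < 2)%N).
by apply: leq_ltn_trans nh; apply: trunc_logP.
Qed.

(* Unlike [bits], this size is additive under the field operations, up to 1, so that
   iterated sums stay polynomially bounded. *)
Definition hgt x : nat := maxn (nbits `|numq x|) (nbits `|denq x|).

Lemma hgt_gt0 x : (0 < hgt x)%N.
Proof. by rewrite /hgt leq_max. Qed.

Lemma hgt_le_bits x : (hgt x <= bits x)%N.
Proof. by rewrite /hgt /bits geq_max; lia. Qed.

Lemma bits_le_hgt x : (bits x <= 1 + 2 * hgt x)%N.
Proof.
have := leq_maxl (nbits `|numq x|) (nbits `|denq x|).
by have := leq_maxr (nbits `|numq x|) (nbits `|denq x|); rewrite /bits /hgt; lia.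
Qed.

Lemma num_lt_hgt x : (`|numq x| < 2 ^ hgt x)%N.
Proof. by apply: leq_trans (ltn_nbits _) _; rewrite leq_exp2l // leq_maxl. Qed.

Lemma den_lt_hgt x : (`|denq x| < 2 ^ hgt x)%N.
Proof. by apply: leq_trans (ltn_nbits _) _; rewrite leq_exp2l // leq_maxr. Qed.

(** Reduction to lowest terms only divides both parts by a common factor, so any fraction for a
    number bounds its height. The field operations follow from their unreduced results. *)
Lemma hgt_frac (n d : int) h : (0 < h)%N -> (`|n| < 2 ^ h)%N -> (`|d| < 2 ^ h)%N ->
  (hgt (n%:Q / d%:Q) <= h)%N.
Proof.
move=> h0 nh dh; have [d0|d0] := eqVneq d 0.
  by rewrite d0 invr0 mulr0 /hgt geq_max !nbits_le ?expn_gt0 ?exp2_gt1.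
case: divqP d0 nh dh => [|k x k0 _ nh dh]; first by rewrite eqxx.
have k1 : (0 < `|k|)%N by rewrite absz_gt0.
rewrite /hgt geq_max !nbits_le //.
  by apply: leq_ltn_trans dh; rewrite abszM leq_pmull.
by apply: leq_ltn_trans nh; rewrite abszM leq_pmull.
Qed.

Lemma hgtD x y : (hgt (x + y) <= hgt x + hgt y + 1)%N.
Proof.
have -> : x + y = (numq x * denq y + numq y * denq x)%:Q / (denq x * denq y)%:Q.
  rewrite -{1}(divq_num_den x) -{1}(divq_num_den y) rmorphD !rmorphM /=.
  by field; rewrite !intr_eq0 !denq_neq0.
have := num_lt_hgt x; have := num_lt_hgt y; have := den_lt_hgt x; have := den_lt_hgt y.
move=> dy dx ny nx; apply: hgt_frac; first by rewrite addn1.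
  rewrite addn1 expnS mul2n -addnn.
  have abszD (m n : int) : (`|(m + n)%R| <= `|m| + `|n|)%N by lia.
  apply: leq_ltn_trans (abszD _ _) _; rewrite !abszM -addSn expnD; apply: leq_add.
    exact: ltn_mul.
  by rewrite [leqRHS]mulnC ltnW // ltn_mul.
rewrite abszM addn1 expnS expnD; apply: leq_trans (ltn_mul dx dy) _.
by rewrite leq_pmull.
Qed.

Lemma hgtM x y : (hgt (x * y) <= hgt x + hgt y)%N.
Proof.
have -> : x * y = (numq x * numq y)%:Q / (denq x * denq y)%:Q.
  rewrite -{1}(divq_num_den x) -{1}(divq_num_den y) !rmorphM /=.
  by field; rewrite !intr_eq0 !denq_neq0.
by apply: hgt_frac; rewrite ?addn_gt0 ?hgt_gt0 // abszM expnD;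
  apply: ltn_mul; rewrite ?num_lt_hgt ?den_lt_hgt.
Qed.

Lemma hgtN x : hgt (- x) = hgt x.
Proof. by rewrite /hgt numqN denqN abszN. Qed.

Lemma hgtB x y : (hgt (x - y) <= hgt x + hgt y + 1)%N.
Proof. by rewrite -(hgtN y) hgtD. Qed.

Lemma hgt_norm x : hgt `|x| = hgt x.
Proof. by case: ger0P => // _; rewrite hgtN. Qed.

Lemma hgtV x : (hgt x^-1 <= hgt x)%N.
Proof.
rewrite -{1}(divq_num_den x) invf_div.
by apply: hgt_frac; rewrite ?hgt_gt0 ?num_lt_hgt ?den_lt_hgt.
Qed.

Lemma hgt_div x y : (hgt (x / y) <= hgt x + hgt y)%N.
Proof. by apply: leq_trans (hgtM _ _) _; rewrite leq_add2l hgtV. Qed.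

Lemma hgt_nat n h : (0 < h)%N -> (n < 2 ^ h)%N -> (hgt n%:R <= h)%N.
Proof.
move=> h0 nh; have -> : n%:R = n%:Z%:Q / 1%:Q :> rat by rewrite divr1 pmulrn.
by apply: hgt_frac; rewrite ?exp2_gt1.
Qed.

Lemma hgt_le_exp2 x : `|x| <= 2 ^+ hgt x.
Proof.
have -> : `|x| = (`|numq x|%N)%:R / (`|denq x|%N)%:R.
  by rewrite -{1}(divq_num_den x) normf_div -!intr_norm !pmulrn !abszE.
rewrite ler_pdivrMr ?ltr0n ?absz_gt0 ?denq_neq0 // -natrX -natrM ler_nat.
apply: leq_trans (ltnW (num_lt_hgt x)) _; rewrite leq_pmulr // absz_gt0.
exact: denq_neq0.
Qed.

(** Together with the upper bound, this makes the number of halvings linear in the heights of the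
    diameter and of the least pair distance. *)
Lemma hgt_ge_exp2 x : 0 < x -> (2 ^+ hgt x)^-1 <= x.
Proof.
move=> x0; have := hgt_le_exp2 x^-1; rewrite gtr0_norm ?invr_gt0 // => h.
rewrite -[x in leRHS]invrK lef_pV2 ?posrE ?invr_gt0 ?exprn_gt0 //.
by apply: le_trans h _; rewrite ler_eXn2l // hgtV.
Qed.

End Height.

(** * A calculus of costs for timed computations *)

Section Costs.
Variable h : nat.
(** The unit of cost: operands of height at most [h] have at most 1 + 2 h bits each, so [opcost] is
    at most the square of 1 + 2 (1 + 2 h). *)
Definition tick : nat := ((3 + 4 * h) ^ 2)%N.

(** A Hoare-style judgement. The postcondition travels with the cost because the price of later
    operations depends on the heights of earlier results. *)
Definition costs (A : Type) (m : timed A) (P : A -> Prop) (j : nat) : Prop :=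
  P m.1 /\ (m.2 <= j * tick)%N.

Lemma tick_gt0 : (0 < tick)%N. Proof. by rewrite expn_gt0. Qed.

Lemma opcost_tick x y : (hgt x <= h)%N -> (hgt y <= h)%N -> (opcost x y <= tick)%N.
Proof.
move=> xh yh; rewrite /opcost /tick leq_sqr.
by have := bits_le_hgt x; have := bits_le_hgt y; lia.
Qed.

Lemma costs_ret (A : Type) (x : A) (P : A -> Prop) j : P x -> (0 < j)%N -> costs (ret x) P j.
Proof. by move=> Px j0; split=> //=; rewrite muln_gt0 j0 tick_gt0. Qed.

(** The strict inequality leaves a unit for the step charged by [bind] itself. *)
Lemma costs_bind (A B : Type) (m : timed A) (f : A -> timed B) P Q j1 j2 j :
  costs m P j1 -> (forall x, P x -> costs (f x) Q j2) -> (j1 + j2 < j)%N ->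
  costs (bind m f) Q j.
Proof.
move=> [Pm mj] /(_ _ Pm)[Qf fj] jj; split=> //=.
apply: leq_trans (leq_mul jj (leqnn _)); rewrite mulSn mulnDl.
by have := tick_gt0; lia.
Qed.

Lemma costsW (A : Type) (m : timed A) (P Q : A -> Prop) j j' :
  costs m P j -> (forall x, P x -> Q x) -> (j <= j')%N -> costs m Q j'.
Proof.
by move=> [Pm mj] PQ jj; split; [exact: PQ|apply: leq_trans mj _; rewrite leq_mul2r jj orbT].
Qed.

Definition hle a x := is_true (hgt x <= a)%N.

Section Ops.
Variables (x y : rat) (a b c : nat).
Hypotheses (xa : hle a x) (yb : hle b y) (ah : (a <= h)%N) (bh : (b <= h)%N).

Let op : (opcost x y <= 1 * tick)%N.
Proof. by rewrite mul1n opcost_tick // ?(leq_trans xa) ?(leq_trans yb). Qed.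

Lemma costs_add : (a + b + 1 <= c)%N -> costs (addT x y) (hle c) 1.
Proof.
move=> abc; split=> //; rewrite /hle /=; apply: leq_trans (hgtD _ _) _.
by apply: leq_trans abc; rewrite leq_add2r leq_add.
Qed.

Lemma costs_sub : (a + b + 1 <= c)%N -> costs (subT x y) (hle c) 1.
Proof.
move=> abc; split=> //; rewrite /hle /=; apply: leq_trans (hgtB _ _) _.
by apply: leq_trans abc; rewrite leq_add2r leq_add.
Qed.

Lemma costs_mul : (a + b <= c)%N -> costs (mulT x y) (hle c) 1.
Proof.
move=> abc; split=> //; rewrite /hle /=; apply: leq_trans (hgtM _ _) _.
by apply: leq_trans abc; rewrite leq_add.
Qed.

Lemma costs_div : (a + b <= c)%N -> costs (divT x y) (hle c) 1.
Proof.
move=> abc; split=> //; rewrite /hle /=; apply: leq_trans (hgt_div _ _) _.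
by apply: leq_trans abc; rewrite leq_add.
Qed.

Lemma costs_le : costs (leT x y) (fun c => c = (x <= y)) 1. Proof. by []. Qed.
Lemma costs_lt : costs (ltT x y) (fun c => c = (x < y)) 1. Proof. by []. Qed.
Lemma costs_eq : costs (eqT x y) (fun c => c = (x == y)) 1. Proof. by []. Qed.

Lemma costs_min : (a <= c)%N -> (b <= c)%N -> costs (minT x y) (hle c) 3.
Proof.
move=> ac bc; apply: (costs_bind (j2 := 1) costs_le) => // e _; apply: costs_ret => //.
by rewrite /hle; case: e; [apply: leq_trans xa _|apply: leq_trans yb _].
Qed.

Lemma costs_max : (a <= c)%N -> (b <= c)%N -> costs (maxT x y) (hle c) 3.
Proof.
move=> ac bc; apply: (costs_bind (j2 := 1) costs_le) => // e _; apply: costs_ret => //.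
by rewrite /hle; case: e; [apply: leq_trans yb _|apply: leq_trans xa _].
Qed.

End Ops.

Lemma costs_abs x a : hle a x -> (a <= h)%N -> costs (absT x) (hle a) 1.
Proof.
move=> xa ah; split; first by rewrite /hle /= hgt_norm.
rewrite mul1n opcost_tick ?(leq_trans xa) //.
apply: leq_trans (_ : _ <= hgt x)%N (leq_trans xa ah).
by rewrite (leq_trans _ (hgt_gt0 x)).
Qed.

End Costs.

(** * Cost and size of results for each routine of the program *)

Section ProgramCosts.
Variables (h H : nat).
Implicit Types (u v : qtraj) (S : seq qtraj) (ts : seq rat).

Definition small u := hle H u.1 /\ hle H u.2.
Definition smalls S := forall u, u \in S -> small u.
Definition hles a ts := forall t, t \in ts -> hle a t.

Lemma smalls_cons u S : smalls (u :: S) -> small u /\ smalls S.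
Proof.
by move=> hS; split=> [|v vS]; apply: hS; rewrite ?mem_head // inE vS orbT.
Qed.

Lemma hles_cons a t ts : hles a (t :: ts) -> hle a t /\ hles a ts.
Proof.
by move=> hS; split=> [|v vS]; apply: hS; rewrite ?mem_head // inE vS orbT.
Qed.

Lemma costs_bind1 (A B : Type) (m : timed A) (f : A -> timed B) P Q j :
  costs h m P 1 -> (forall x, P x -> costs h (f x) Q j) -> costs h (bind m f) Q j.+2.
Proof. by move=> hm hf; apply: costs_bind hm hf _. Qed.

Lemma hle2 : hle 2 2.
Proof. exact: (@hgt_nat 2 2). Qed.
Lemma hle1 : hle 1 1.
Proof. exact: (@hgt_nat 1 1). Qed.
Lemma hle0 : hle 1 0.
Proof. exact: (@hgt_nat 0 1). Qed.

(** From the opposite-sign branch of [pair_diamT]: numerator of height 12 H + 9, denominator of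
    height 2 H + 3. *)
Notation hpair := (14 * H + 12)%N.
Hypothesis hpair_le : (hpair <= h)%N.

Lemma costs_pair_diam u v : small u -> small v ->
  costs h (pair_diamT u v) (hle hpair) 21.
Proof.
move=> [u1 u2] [v1 v2].
apply: costs_bind1 (costs_sub (c := 2 * H + 1) u1 v1 _ _ _) _; try lia; move=> d0 h0.
apply: costs_bind1 (costs_sub (c := 2 * H + 1) u2 v2 _ _ _) _; try lia; move=> dv hv.
apply: costs_bind1 (costs_add (c := 4 * H + 3) h0 hv _ _ _) _; try lia; move=> d1 h1.
apply: costs_bind1 (costs_mul (c := 6 * H + 4) h0 h1 _ _ _) _; try lia; move=> p hp.
apply: costs_bind1 (costs_le hle0 hp _ _) _; try lia; move=> [] _.
  apply: (@costsW _ _ _ (hle (6 * H + 7)) _ 5); last by [].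
    apply: costs_bind1 (costs_add (c := 6 * H + 5) h0 h1 _ _ _) _; try lia; move=> s hs.
    apply: costs_bind1 (costs_abs hs _) _; try lia; move=> a ha.
    by apply: costs_div ha hle2 _ _ _; lia.
  by move=> x /leq_trans; apply; lia.
apply: costs_bind1 (costs_mul (c := 4 * H + 2) h0 h0 _ _ _) _; try lia; move=> q0 hq0.
apply: costs_bind1 (costs_mul (c := 8 * H + 6) h1 h1 _ _ _) _; try lia; move=> q1 hq1.
apply: costs_bind1 (costs_add (c := 12 * H + 9) hq0 hq1 _ _ _) _; try lia; move=> q hq.
apply: costs_bind1 (costs_abs hv _) _; try lia; move=> a ha.
apply: costs_bind1 (costs_mul (c := 2 * H + 3) hle2 ha _ _ _) _; try lia; move=> a2 ha2.
by apply: costs_div hq ha2 _ _ _; lia.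
Qed.

Lemma costs_pos u (t : rat) a : small u -> hle a t -> (2 * H + a + 1 <= h)%N ->
  costs h (posT u t) (hle (2 * H + a + 1)) 3.
Proof.
move=> [u1 u2] ta ah.
apply: costs_bind1 (costs_mul (c := H + a) u2 ta _ _ _) _; try lia; move=> y hy.
by apply: costs_add u1 hy _ _ _; lia.
Qed.

(** A crossing time is a quotient of two differences of height 2 H + 1. *)
Notation hcross := (4 * H + 2)%N.

Lemma costs_insert (x : rat) ts : hle hcross x -> hles hcross ts ->
  costs h (insertT x ts)
    (fun r => hles hcross r /\ size r = (size ts).+1) (4 * size ts + 1).
Proof.
move=> hx; elim: ts => [|t ts IH] hts /=.
  by apply: costs_ret => //; split=> // t; rewrite inE => /eqP ->.
have [ht hts'] := hles_cons hts.
rewrite mulnS addnAC -[(4 + 1)%N]/3.+2 addSn addSn.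
apply: costs_bind1 (costs_le hx ht _ _) _; try lia; move=> [] _.
  apply: costs_ret; last by rewrite addSn.
  by split=> // y; rewrite inE => /orP[/eqP -> //|]; exact: hts.
apply: (costs_bind (j2 := 1) (IH hts')); last by lia.
move=> r [hr sr]; apply: costs_ret => //; split; last by rewrite /= sr.
by move=> y; rewrite inE => /orP[/eqP -> //|]; exact: hr.
Qed.

(** [L] bounds the list of times throughout the row, so that all insertions share one cost bound
    although the list grows. *)
Lemma costs_cross_row u S ts L : small u -> smalls S -> hles hcross ts ->
  (size ts + size S <= L)%N ->
  costs h (cross_rowT u S ts)
    (fun r => hles hcross r /\ (size r <= size ts + size S)%N)
    (size S * (4 * L + 20) + 1).
Proof.
move=> [u1 u2]; elim: S ts => [|v S IH] ts hS hts /= hL.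
  by apply: costs_ret => //; split=> //; rewrite addn0.
have [[v1 v2] hS'] := smalls_cons hS.
have mono m c : costs h m (fun r => hles hcross r /\ (size r <= size ts + size S)%N) c ->
    costs h m (fun r => hles hcross r /\ (size r <= size ts + (size S).+1)%N) c.
  by move=> hm; apply: costsW hm _ _ => // r [? ?]; split=> //; lia.
have IHt := mono _ _ (IH _ hS' hts (_ : _ <= L)%N).
have {}IHt := IHt (leq_trans (leq_add (leqnn _) (leqnSn _)) hL).
set X := (size S * _)%N in IHt *.
have -> : ((size S).+1 * (4 * L + 20) + 1 = (X + 4 * L + 9).+2.+2.+2.+2.+2.+2)%N.
  by rewrite mulSn /X; lia.
apply: costs_bind1 (costs_sub (c := 2 * H + 1) u2 v2 _ _ _) _; try lia; move=> dv hdv.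
apply: costs_bind1 (costs_eq hdv hle0 _ _) _; try lia; move=> [] _.
  by apply: costsW IHt _ _ => //; lia.
apply: costs_bind1 (costs_sub (c := 2 * H + 1) v1 u1 _ _ _) _; try lia; move=> dx hdx.
apply: costs_bind1 (costs_div (c := hcross) hdx hdv _ _ _) _; try lia; move=> t ht.
apply: costs_bind1 (costs_lt hle0 ht _ _) _; try lia; move=> c0 _.
apply: costs_bind1 (costs_lt ht hle1 _ _) _; try lia; move=> c1 _.
case: ifP => _; last by apply: costsW IHt _ _ => //; lia.
apply: (costs_bind (j2 := X + 1) (costs_insert ht hts)); last by lia.
move=> r [hr sr]; have := IH r hS' hr; rewrite sr addSnnS; apply; lia.
Qed.

Lemma costs_cross S ts n L : smalls S -> hles hcross ts -> (size S <= n)%N ->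
  (size ts + size S * n <= L)%N ->
  costs h (crossT S ts)
    (fun r => hles hcross r /\ (size r <= size ts + size S * n)%N)
    (size S * (n * (4 * L + 20) + 3) + 1).
Proof.
elim: S ts => [|v S IH] ts hS hts /= hn hL.
  by apply: costs_ret => //; split=> //; rewrite addn0.
have [hv hS'] := smalls_cons hS.
have row := costs_cross_row hv hS' hts (_ : _ <= L)%N.
have {}row : costs h (cross_rowT v S ts)
    (fun r => hles hcross r /\ (size r <= size ts + n)%N) (n * (4 * L + 20) + 1).
  apply: costsW (row _) _ _.
  - by move: hL; rewrite mulSn; lia.
  - by move=> r [? ?]; split=> //; lia.
  - by rewrite leq_add2r leq_mul2r (ltnW hn) orbT.
apply: (costs_bind (j2 := size S * (n * (4 * L + 20) + 3) + 1) row).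
  move=> r [hr sr]; apply: costsW (IH r hS' hr (ltnW hn) _) _ _ => //.
    by move: hL; rewrite mulSn; lia.
  by move=> r' [? ?]; split=> //; rewrite mulSn; lia.
by rewrite mulSn; lia.
Qed.

(** Heights of a position at a crossing time and of a difference of two such positions. *)
Notation hpos := (6 * H + 3)%N.
Notation hwidth := (12 * H + 7)%N.

Lemma costs_extrema S (t lo hi : rat) : smalls S -> hle hcross t ->
  hle hpos lo -> hle hpos hi ->
  costs h (extremaT S t lo hi) (fun e => hle hpos e.1 /\ hle hpos e.2)
    (12 * size S + 1).
Proof.
move=> + ht; elim: S lo hi => [|u S IH] lo hi hS hlo hhi /=; first exact: costs_ret.
have [hu hS'] := smalls_cons hS.
apply: (costs_bind (j2 := 12 * size S + 9) (costs_pos hu ht _)); try lia; move=> x hx.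
have {}hx : hle hpos x by apply: leq_trans hx _; lia.
apply: (costs_bind (j2 := 12 * size S + 5) (costs_min (c := hpos) hlo hx _ _ _ _)); try lia.
move=> lo' hlo'.
apply: (costs_bind (j2 := 12 * size S + 1) (costs_max (c := hpos) hhi hx _ _ _ _)); try lia.
by move=> hi' hhi'; exact: IH.
Qed.

Lemma costs_width S (t : rat) : smalls S -> hle hcross t ->
  costs h (widthT S t) (hle hwidth) (12 * size S + 8).
Proof.
case: S => [|u S] hS ht /=.
  by apply: costs_ret => //; apply: leq_trans hle0 _; lia.
have [hu hS'] := smalls_cons hS.
apply: (costs_bind (j2 := 12 * size S + 5) (costs_pos hu ht _)); try lia; move=> x hx.
have {}hx : hle hpos x by apply: leq_trans hx _; lia.
apply: (costs_bind (j2 := 1) (costs_extrema hS' ht hx hx)); last by lia.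
by move=> e [h1 h2]; apply: costs_sub h2 h1 _ _ _; lia.
Qed.

(** A trapezoid has height 32 H + 22; one more pays for adding it to the rest. *)
Notation harea := (32 * H + 23)%N.

(** Since heights add up under addition, the height of the total area is linear in the number of
    intervals. *)
Lemma costs_sweep S (t0 w0 : rat) ts : smalls S -> hles hcross ts ->
  hle hcross t0 -> hle hwidth w0 -> (size ts * harea + 1 <= h)%N ->
  (harea <= h)%N ->
  costs h (sweepT S t0 w0 ts) (hle (size ts * harea + 1))
    (size ts * (12 * size S + 20) + 1).
Proof.
move=> hS + + + + ha; elim: ts t0 w0 => [|t ts IH] t0 w0 hts ht0 hw0 hh /=.
  by apply: costs_ret => //; exact: hle0.
have [ht hts'] := hles_cons hts.
have {}hh : (harea + size ts * harea + 1 <= h)%N by rewrite -mulSn.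
set X := (size ts * (12 * size S + 20))%N.
apply: (costs_bind (j2 := X + 11) (costs_width hS ht)); last by rewrite mulSn -/X; lia.
move=> w1 hw1; rewrite (_ : X + 11 = (X + 3).+2.+2.+2.+2)%N; last by lia.
apply: costs_bind1 (costs_sub (c := 8 * H + 5) ht ht0 _ _ _) _; try lia; move=> d hd.
apply: costs_bind1 (costs_add (c := 24 * H + 15) hw0 hw1 _ _ _) _; try lia; move=> w hw.
apply: costs_bind1 (costs_mul (c := 32 * H + 20) hd hw _ _ _) _; try lia; move=> p hp.
apply: costs_bind1 (costs_div (c := 32 * H + 22) hp hle2 _ _ _) _; try lia; move=> ar har.
apply: (costs_bind (j2 := 1) (IH t w1 hts' ht hw1 _)); try lia.
move=> r hr; apply: (costs_add har hr); try lia.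
Qed.

Lemma costs_diam S n : smalls S -> (size S <= n)%N ->
  let hdiam := ((1 + n * n) * harea + 1)%N in (hdiam <= h)%N ->
  costs h (diamT S) (hle hdiam)
    (n * (n * (4 * (1 + n * n) + 20) + 3) + (1 + n * n) * (12 * n + 20) + 12 * n + 12)%N.
Proof.
move=> hS hn hdiam hh.
have h1 : hles hcross [:: 1].
  by move=> t; rewrite inE => /eqP ->; apply: leq_trans hle1 _; lia.
have hL : (size [:: 1 : rat] + size S * n <= 1 + n * n)%N.
  by rewrite leq_add2l leq_mul2r hn orbT.
set c1 := (n * (n * (4 * (1 + n * n) + 20) + 3))%N.
set c2 := ((1 + n * n) * (12 * n + 20))%N.
have crossc : costs h (crossT S [:: 1])
    (fun r => hles hcross r /\ (size r <= 1 + n * n)%N) (c1 + 1).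
  apply: costsW (costs_cross hS h1 hn hL) _ _.
    by move=> r [? sr]; split=> //; apply: leq_trans sr hL.
  by rewrite leq_add2r leq_mul2r hn orbT.
apply: (costs_bind (j2 := c2 + 12 * n + 10) crossc); last by lia.
move=> ts [hts sts].
have hc0 : hle hcross 0 by apply: leq_trans hle0 _; lia.
have wc : costs h (widthT S 0) (hle hwidth) (12 * n + 8).
  by apply: costsW (costs_width hS hc0) _ _ => //; lia.
apply: (costs_bind (j2 := c2 + 1) wc); last by lia.
move=> w0 hw0.
have hs : (size ts * harea + 1 <= hdiam)%N by rewrite leq_add2r leq_mul2r sts orbT.
apply: costsW (costs_sweep hS hts hc0 hw0 _ _) _ _.
- exact: leq_trans hs hh.
- by apply: leq_trans hh; rewrite /hdiam mulnDl; lia.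
- by move=> x /leq_trans; apply.
- by rewrite leq_add2r; apply: leq_mul; lia.
Qed.

Definition ohle a (acc : option rat) := forall x, acc = Some x -> hle a x.

Lemma costs_min_row u S acc : small u -> smalls S -> ohle hpair acc ->
  costs h (min_rowT u S acc) (ohle hpair) (27 * size S + 1).
Proof.
move=> hu; elim: S acc => [|v S IH] acc hS hacc /=; first exact: costs_ret.
have [hv hS'] := smalls_cons hS.
apply: (costs_bind (j2 := 27 * size S + 5) (costs_pair_diam hu hv)); try lia; move=> d hd.
apply: (@costs_bind _ _ _ _ _ (hle hpair) _ 3 (27 * size S + 1)); last by lia.
  case: acc hacc => [x|] hacc; last exact: costs_ret.
  by apply: costs_min (hacc _ erefl) hd _ _ _ _; lia.
by move=> m hm; apply: IH => // x [<-].
Qed.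

Lemma costs_min_pairs S acc n : smalls S -> (size S <= n)%N -> ohle hpair acc ->
  costs h (min_pairsT S acc) (ohle hpair) (size S * (27 * n + 2) + 1).
Proof.
elim: S acc => [|v S IH] acc hS hn hacc /=; first exact: costs_ret.
have [hv hS'] := smalls_cons hS.
apply: (costs_bind (j2 := size S * (27 * n + 2) + 1) (costs_min_row hv hS' hacc)).
  by move=> acc' hacc'; apply: IH => //; exact: ltnW.
by rewrite mulSn /= in hn *; lia.
Qed.

Lemma costs_min_pair S n : smalls S -> (size S <= n)%N ->
  costs h (min_pair_diamT S) (hle hpair) (n * (27 * n + 2) + 3).
Proof.
move=> hS hn; apply: (costs_bind (j2 := 1) (costs_min_pairs hS hn (_ : ohle hpair None))).
- by [].
- move=> [x|] hx; apply: costs_ret => //=; first exact: hx.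
  by apply: leq_trans hle0 _; lia.
- have : (size S * (27 * n + 2) <= n * (27 * n + 2))%N by rewrite leq_mul2r hn orbT.
  lia.
Qed.

Lemma costs_lefter u v : small u -> small v -> costs h (lefterT u v) (fun _ => True) 13.
Proof.
move=> hu hv; have [u1 u2] := hu; have [v1 v2] := hv.
apply: costs_bind1 (costs_lt u1 v1 _ _) _; try lia; move=> [] _; first exact: costs_ret.
apply: costs_bind1 (costs_lt v1 u1 _ _) _; try lia; move=> [] _; first exact: costs_ret.
apply: (costs_bind (j2 := 5) (costs_pos hu hle1 _)); try lia; move=> x hx.
apply: (costs_bind (j2 := 1) (costs_pos hv hle1 _)); try lia; move=> y hy.
by apply: costsW (costs_le hx hy _ _) _ _ => //; lia.
Qed.

Lemma costs_leftmost u S : small u -> smalls S ->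
  costs h (leftmostT u S) small (15 * size S + 1).
Proof.
elim: S u => [|v S IH] u hu hS /=; first exact: costs_ret.
have [hv hS'] := smalls_cons hS.
apply: (costs_bind (j2 := 15 * size S + 1) (costs_lefter hv hu)); last by lia.
by move=> b _; apply: IH => //; case: b.
Qed.

Lemma costs_split D u S a : hle a D -> (a <= h)%N -> small u -> smalls S ->
  costs h (splitT D u S) (fun p => smalls p.2 /\ (size p.2 <= size S)%N)
    (28 * size S + 1).
Proof.
move=> hD ah hu; elim: S => [|v S IH] hS /=; first exact: costs_ret.
have [hv hS'] := smalls_cons hS.
apply: (costs_bind (j2 := 28 * size S + 5) (costs_pair_diam hu hv)); try lia; move=> d hd.
rewrite (_ : 28 * size S + 5 = (28 * size S + 3).+2)%N; last by lia.
apply: costs_bind1 (costs_le hd hD _ _) _; try lia; move=> c _.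
apply: (costs_bind (j2 := 1) (IH hS')); try lia; move=> p [hp sp].
apply: costs_ret => //; case: c => /=; split=> //; try lia.
by move=> w; rewrite inE => /orP[/eqP -> //|]; exact: hp.
Qed.

Lemma costs_greedy_rec d S D n a : hle a D -> (a <= h)%N -> smalls S -> (size S <= n)%N ->
  costs h (greedy_recT d S D) (fun G => size G <= d)%N (d * (43 * n + 8) + 1).
Proof.
move=> hD ah; elim: d S => [|d IH] S hS hn /=; first exact: costs_ret.
case: S hS hn => [|u S] hS hn; first by apply: costs_ret; rewrite ?addn1.
have [hu hS'] := smalls_cons hS; rewrite /= in hn.
set X := (d * (43 * n + 8))%N.
apply: (costs_bind (j2 := X + 28 * n + 5) (costs_leftmost hu hS')); last first.
  by rewrite mulSn -/X; lia.
move=> s hs.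
apply: (costs_bind (j2 := X + 3) (costs_split hD ah hs hS)); last by move=> /=; lia.
move=> p [hp sp]; apply: (costs_bind (j2 := 1) (IH _ hp _)).
- by apply: leq_trans sp _.
- by move=> r hr; apply: costs_ret.
- by rewrite -/X; lia.
Qed.

End ProgramCosts.

(** * Values computed by the implementation *)

Section Values.
Variable R : realType.
Notation mu := (@lebesgue_measure R).
Notation rt := (@real_traj R).
Notation rc := (@real_cluster R).
Implicit Types (u v : qtraj) (S : seq qtraj) (ts : seq rat).

Definition qpos u (t : rat) : rat := u.1 + u.2 * t.

Lemma real_traj_inj : injective rt.
Proof. by move=> [a b] [c d] [] /fmorph_inj -> /fmorph_inj ->. Qed.

Lemma mem_real_cluster S u : (rt u \in rc S) = (u \in S).
Proof. by rewrite /real_cluster mem_imfset //; exact: real_traj_inj. Qed.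

Lemma real_clusterP S (x : traj R) :
  reflect (exists2 u, u \in S & x = rt u) (x \in rc S).
Proof. exact: imfsetP. Qed.

Lemma card_real_cluster S : uniq S -> #|` rc S| = size S.
Proof.
move=> uS; rewrite /real_cluster card_imfset /=; last exact: real_traj_inj.
by rewrite undup_id.
Qed.

Lemma pos_ratr u t : pos (rt u) (ratr t) = ratr (qpos u t) :> R.
Proof. by rewrite /pos /qpos rmorphD rmorphM. Qed.

Lemma ratr_pair_diam (d0 dv : rat) :
  ratr (pair_diam d0 dv) = pair_diam (ratr d0) (ratr dv) :> R.
Proof.
have d1E : ratr d0 + ratr dv = ratr (d0 + dv) :> R by rewrite rmorphD.
have -> : pair_diam (ratr d0) (ratr dv) = if 0 <= d0 * (d0 + dv)
    then `|ratr d0 + ratr (d0 + dv)| / 2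
    else (ratr d0 * ratr d0 + ratr (d0 + dv) * ratr (d0 + dv)) / (2 * `|ratr dv|) :> R.
  by rewrite /pair_diam d1E -(ler0q R) rmorphM.
rewrite /pair_diam; case: ifP => _; rewrite fmorph_div /=.
  by rewrite ratr_norm rmorphD rmorph_nat.
by rewrite (rmorphD (@ratr R) (d0 * d0)) /= !rmorphM /= ratr_norm rmorph_nat.
Qed.

Lemma pair_diamT_val u v : (pair_diamT u v).1 = pair_diam (u.1 - v.1) (u.2 - v.2).
Proof. by rewrite /pair_diam /=; case: ifP. Qed.

Lemma ratr_pair_diamT u v :
  ratr (pair_diamT u v).1 = diam [fset rt u; rt v]%fset :> R.
Proof. by rewrite pair_diamT_val ratr_pair_diam diam_pair /= !rmorphB. Qed.

Lemma insertT_perm (x : rat) ts : perm_eq (insertT x ts).1 (x :: ts).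
Proof.
elim: ts => //= t ts IH; case: ifP => //= _.
rewrite -(perm_cons t) in IH; apply: perm_trans IH _.
exact/permPl/(perm_catCA [:: t] [:: x]).
Qed.

Lemma insertT_sorted (x : rat) ts : sorted <=%R ts -> sorted <=%R (insertT x ts).1.
Proof.
elim: ts => //= t ts IH hp; case: ifPn => /=; first by move=> ->.
rewrite -ltNge => /ltW tx.
move: hp; rewrite !(path_sortedE le_trans) => /andP[hall hs]; rewrite IH // andbT.
by rewrite (perm_all _ (insertT_perm x ts)) /= tx.
Qed.

Definition crossing u v : rat := (v.1 - u.1) / (u.2 - v.2).

Lemma crossingC u v : crossing u v = crossing v u.
Proof. by rewrite /crossing -(opprB v.1) -(opprB u.2) invrN mulrNN. Qed.

Lemma cross_rowT_val u S ts : sorted <=%R ts ->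
  let r := (cross_rowT u S ts).1 in
  [/\ sorted <=%R r, {subset ts <= r},
      forall t, t \in r -> t \in ts \/ 0 < t < 1
    & forall v, v \in S -> u.2 != v.2 -> 0 < crossing u v < 1 -> crossing u v \in r].
Proof.
elim: S ts => [|v S IH] ts hts /=; first by split=> // t; left.
case: ifPn => [/eqP par|npar].
  have [h1 h2 h3 h4] := IH ts hts; split=> // w.
  by rewrite inE => /orP[/eqP ->|/h4 //]; rewrite (subr0_eq par) eqxx.
rewrite /= -/(crossing u v); case: ifPn => c01.
  have [h1 h2 h3 h4] := IH _ (insertT_sorted (crossing u v) hts).
  have memi t : (t \in (insertT (crossing u v) ts).1) = (t == crossing u v) || (t \in ts).
    by rewrite (perm_mem (insertT_perm _ _)) inE.
  split=> //.
  - by move=> t tts; apply: h2; rewrite memi tts orbT.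
  - move=> t /h3[|]; last by right.
    by rewrite memi => /orP[/eqP ->|]; [right|left].
  - move=> w; rewrite inE => /orP[/eqP -> _ _|/h4 //].
    by apply: h2; rewrite memi eqxx.
have [h1 h2 h3 h4] := IH ts hts; split=> // w.
by rewrite inE => /orP[/eqP -> _ /(elimN idP c01)//|/h4].
Qed.

Lemma crossT_val S ts : sorted <=%R ts ->
  let r := (crossT S ts).1 in
  [/\ sorted <=%R r, {subset ts <= r},
      forall t, t \in r -> t \in ts \/ 0 < t < 1
    & forall u v, u \in S -> v \in S -> u.2 != v.2 -> 0 < crossing u v < 1 ->
        crossing u v \in r].
Proof.
elim: S ts => [|u S IH] ts hts /=; first by split=> // t; left.
have [r1 r2 r3 r4] := cross_rowT_val u S hts.
have [h1 h2 h3 h4] := IH _ r1; split=> //.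
- by move=> t /r2/h2.
- by move=> t /h3[/r3|]; [|right].
- move=> a b; rewrite !inE => /orP[/eqP ->|aS] /orP[/eqP ->|bS]; first by rewrite eqxx.
  + by move=> ? ?; apply/h2/r4.
  + by rewrite eq_sym crossingC => ? ?; apply/h2/r4.
  + exact: h4.
Qed.

Lemma extremaT_val S (t lo hi : rat) :
  let e := (extremaT S t lo hi).1 in
  [/\ e.1 <= lo, hi <= e.2, e.1 \in lo :: [seq qpos l t | l <- S],
      e.2 \in hi :: [seq qpos l t | l <- S]
    & forall l, l \in S -> e.1 <= qpos l t <= e.2].
Proof.
elim: S lo hi => [|u S IH] lo hi /=; first by rewrite !mem_head !lexx.
rewrite -/(qpos u t); set lo' := if lo <= _ then _ else _; set hi' := if hi <= _ then _ else _.
have [h1 h2 h3 h4 h5] := IH lo' hi'.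
have lo1 : lo' <= lo by rewrite /lo'; case: (leP lo (qpos u t)) => // /ltW.
have lo2 : lo' <= qpos u t by rewrite /lo'; case: (leP lo (qpos u t)).
have hi1 : hi <= hi' by rewrite /hi'; case: (leP hi (qpos u t)).
have hi2 : qpos u t <= hi' by rewrite /hi'; case: (leP hi (qpos u t)) => // /ltW.
split.
- exact: le_trans lo1.
- exact: le_trans hi1 h2.
- move: h3; rewrite !inE => /orP[/eqP ->|->]; last by rewrite !orbT.
  by rewrite /lo'; case: ifP; rewrite eqxx ?orbT.
- move: h4; rewrite !inE => /orP[/eqP ->|->]; last by rewrite !orbT.
  by rewrite /hi'; case: ifP; rewrite eqxx ?orbT.
- move=> l; rewrite inE => /orP[/eqP ->|/h5 //].
  by rewrite (le_trans h1 lo2) (le_trans hi2 h2).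
Qed.

Lemma ratr_widthT S t : S != [::] -> width (rc S) (ratr t) = ratr (widthT S t).1 :> R.
Proof.
case: S => // u S _; have := extremaT_val S t (qpos u t) (qpos u t).
rewrite [(widthT _ _).1]/= -/(qpos u t).
case: (extremaT S t _ _) => [[lo hi] c] /= [h1 h2 lo_in hi_in h5].
have /mapP[j jS loE] : lo \in [seq qpos l t | l <- u :: S] by exact: lo_in.
have /mapP[i iS hiE] : hi \in [seq qpos l t | l <- u :: S] by exact: hi_in.
rewrite (@width_extremal _ _ _ (rt i) (rt j)) ?pos_ratr -?loE -?hiE ?rmorphB //.
split; rewrite ?mem_real_cluster // => x /real_clusterP[l lS ->].
rewrite !pos_ratr -loE -hiE !ler_rat.
by move: lS; rewrite inE => /orP[/eqP ->|/h5 //]; rewrite h1.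
Qed.

(** Rational trajectories of different slopes meet at a rational time, so no real crossing escapes
    the program. *)
Lemma crossing_real u v (x : R) : u.2 != v.2 -> pos (rt u) x = pos (rt v) x ->
  x = ratr (crossing u v).
Proof.
move=> uv; rewrite /pos /crossing /= fmorph_div /= !rmorphB /= => h.
have uv' : ratr u.2 - ratr v.2 != 0 :> R by rewrite subr_eq0 (inj_eq (fmorph_inj _)).
by apply: (mulIf uv'); rewrite divfK //; lra.
Qed.

Lemma real_cluster_neq0 S : S != [::] -> rc S != fset0.
Proof.
case: S => // u S _; apply/fset0Pn; exists (rt u).
by rewrite mem_real_cluster mem_head.
Qed.

Lemma path_le_last (t0 : rat) ts : path <=%R t0 ts ->
  forall x, x \in t0 :: ts -> x <= last t0 ts.
Proof.
elim: ts t0 => [|t1 ts IH] t0 /=; first by move=> _ x; rewrite inE => /eqP ->.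
move=> /andP[t01 /IH h] x; rewrite inE => /orP[/eqP ->|/h //].
by apply: le_trans t01 (h _ _); rewrite mem_head.
Qed.

(** The clause on crossings after [t0] is the induction invariant: none falls strictly between [t0]
    and the head of [ts], so the width is affine there. *)
Lemma sweepT_val S t0 ts : S != [::] -> path <=%R t0 ts -> last t0 ts = 1 ->
  (forall u v, u \in S -> v \in S -> u.2 != v.2 -> t0 < crossing u v < 1 ->
     crossing u v \in ts) ->
  ratr (sweepT S t0 (widthT S t0).1 ts).1 =
    \int[mu]_(t in `[ratr t0, 1]) width (rc S) t :> R.
Proof.
move=> S0; elim: ts t0 => [|t1 ts IH] t0 /=.
  by move=> _ -> _; rewrite !rmorph0 rmorph1 set_itv1 Rintegral_set1.
move=> /andP[t01 hp] hl hc.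
have t1le t : t \in ts -> t1 <= t.
  by move: hp; rewrite (path_sortedE le_trans) => /andP[/allP h _]; exact: h.
have t11 : t1 <= 1.
  by rewrite -hl; case: ts t1le {IH hp hl hc} => //= t ts h; apply: h; exact: mem_last.
have rS0 := real_cluster_neq0 S0.
have cw := width_continuous rS0.
rewrite rmorphD /= IH //; last first.
  move=> u v uS vS uv /andP[h1 h2].
  have := hc u v uS vS uv; rewrite h2 (le_lt_trans t01 h1) => /(_ isT).
  by rewrite inE => /orP[/eqP E|//]; rewrite E ltxx in h1.
have rt01 : ratr t0 <= ratr t1 :> R by rewrite ler_rat.
have rt11 : ratr t1 <= 1 :> R by rewrite -(rmorph1 (@ratr R)) ler_rat.
rewrite (Rintegral_itv_split cw rt01 rt11); congr (_ + _).
have [|p [q aff]] := width_affine rS0 rt01.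
  move=> _ _ x /real_clusterP[u uS ->] /real_clusterP[v vS ->] xt hx.
  have [E|uv] := eqVneq u.2 v.2; first by rewrite /= E.
  have xE := crossing_real uv hx; move: xt; rewrite xE !ltr_rat => /andP[h1 h2].
  have := hc u v uS vS uv; rewrite h1 (lt_le_trans h2 t11) => /(_ isT).
  by rewrite inE => /orP[/eqP E|/t1le]; [rewrite E ltxx in h2|rewrite leNgt h2].
rewrite (Rintegral_trapezoid rt01 aff) !ratr_widthT //.
by rewrite fmorph_div /= rmorphM /= rmorphB rmorphD rmorph_nat.
Qed.

Lemma diamT_val S : S != [::] -> ratr (diamT S).1 = diam (rc S) :> R.
Proof.
move=> S0; have [h1 h2 h3 h4] := @crossT_val S [:: 1] isT.
rewrite diamE ?real_cluster_neq0 // -(rmorph0 (@ratr R)).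
set r := (crossT S [:: 1]).1 in h1 h2 h3 h4.
have r01 t : t \in r -> 0 <= t <= 1.
  by move=> /h3[|/andP[/ltW -> /ltW ->]//]; rewrite inE => /eqP ->.
have pr : path <=%R 0 r.
  rewrite (path_sortedE le_trans).
  by rewrite h1 andbT; apply/allP => t /r01/andP[].
apply: (sweepT_val S0 pr); last by move=> u v uS vS uv; exact: h4.
(* The list was seeded with 1 and has nothing beyond it, so the sweep ends at 1. *)
have r1 : 1 \in r by apply: h2; rewrite inE.
apply/eqP; rewrite eq_le (path_le_last pr) ?inE ?r1 ?orbT // andbT.
by have := mem_last 0 r; rewrite inE => /orP[/eqP ->//|/r01/andP[]].
Qed.

End Values.

(** * Agreement of the least pair distance and of the greedy partition *)

Section AlgorithmValues.
Variable R : realType.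
Notation rt := (@real_traj R).
Notation rc := (@real_cluster R).
Implicit Types (u v : qtraj) (S : seq qtraj).

Lemma ratr_inj : injective (@ratr R).
Proof. exact: fmorph_inj. Qed.

Definition is_min (acc : option rat) (P : rat -> Prop) : Prop :=
  match acc with
  | Some m => P m /\ forall x, P x -> m <= x
  | None => forall x, ~ P x
  end.

Lemma is_min_ext acc (P Q : rat -> Prop) :
  (forall x, P x <-> Q x) -> is_min acc P -> is_min acc Q.
Proof.
move=> PQ; case: acc => [m|] /=; last by move=> h x /PQ; exact: h.
by case=> /PQ Qm h; split=> // x /PQ; exact: h.
Qed.

Lemma is_min_add acc P (d : rat) : is_min acc P ->
  is_min (Some (if acc is Some x then minT x d else ret d).1) (fun x => P x \/ x = d).
Proof.
case: acc => [m|] /=; last by move=> h; split; [right|move=> x [/h|->]].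
case=> Pm h; case: (leP m d) => md; split; [by left| |by right|].
  by move=> x [/h|->].
by move=> x [/h|-> //]; apply: le_trans; exact: ltW.
Qed.

Lemma min_rowT_val u S acc P : is_min acc P ->
  is_min (min_rowT u S acc).1
    (fun x => P x \/ exists2 v, v \in S & x = (pair_diamT u v).1).
Proof.
elim: S acc P => [|v S IH] acc P hP.
  by apply: is_min_ext hP => x; split; [left|case=> // -[]].
rewrite [min_rowT _ _ _]/=; apply: is_min_ext (IH _ _ (is_min_add _ hP)) => x; split.
  move=> [[Px|->]|[w wS ->]]; first by left.
    by right; exists v; rewrite ?mem_head.
  by right; exists w; rewrite // inE wS orbT.
move=> [Px|[w]]; first by do 2 left.
rewrite inE => /orP[/eqP -> ->|wS ->]; first by left; right.
by right; exists w.
Qed.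

(** Follows the nested loops, which visit each unordered pair once; [pair_valueP] recovers ordered
    pairs through the symmetry of the distance. *)
Fixpoint pair_value S (x : rat) : Prop :=
  if S is u :: S' then
    (exists2 v, v \in S' & x = (pair_diamT u v).1) \/ pair_value S' x
  else False.

Lemma min_pairsT_val S acc P : is_min acc P ->
  is_min (min_pairsT S acc).1 (fun x => P x \/ pair_value S x).
Proof.
elim: S acc P => [|u S IH] acc P hP.
  by apply: is_min_ext hP => x; split; [left|case].
by apply: is_min_ext (IH _ _ (min_rowT_val u S hP)) => x /=; tauto.
Qed.

Lemma pair_valueP S : uniq S -> forall x, pair_value S x <->
  exists u v, [/\ u \in S, v \in S, u <> v & ratr x = diam [fset rt u; rt v]%fset].
Proof.
elim: S => [|u S IH] /=; first by move=> _ x; split=> // -[u [v []]].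
move=> /andP[uS /IH {}IH] x; split.
  move=> [[v vS ->]|/IH[a [b [aS bS ab ->]]]].
    exists u, v; rewrite ratr_pair_diamT !inE vS eqxx orbT; split=> // uv.
    by rewrite uv vS in uS.
  by exists a, b; rewrite !inE aS bS !orbT.
move=> [a [b [+ + ab xE]]]; rewrite !inE => /orP[/eqP aE|aS] /orP[/eqP bE|bS].
- by case: ab; rewrite aE bE.
- left; exists b => //; apply: ratr_inj.
  by rewrite xE aE; exact/esym/ratr_pair_diamT.
- left; exists a => //; apply: ratr_inj.
  rewrite xE bE fsetUC; exact/esym/ratr_pair_diamT.
- by right; apply/IH; exists a, b.
Qed.

Lemma min_pair_diamT_val S : uniq S ->
  ratr (min_pair_diamT S).1 = min_pair_diam (rc S) :> R.
Proof.
move=> uS; have := @min_pairsT_val S None (fun _ => False) (fun _ => id).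
rewrite /min_pair_diamT [(bind _ _).1]/=.
have mem : forall u v, u \in S -> v \in S -> u <> v -> pair_value S (pair_diamT u v).1.
  by move=> u v aS bS uv; apply/(pair_valueP uS); exists u, v; rewrite ratr_pair_diamT.
case: (min_pairsT S None).1 => [m|] /=.
  move=> [[//|/(pair_valueP uS)[u [v [uS' vS' uv mE]]]] h].
  apply/esym/inf_minimum.
    exists (rt u), (rt v); rewrite !mem_real_cluster mE; split=> // /real_traj_inj.
    exact: uv.
  move=> _ [_ [_ [/real_clusterP[a aS ->] /real_clusterP[b bS ->] ab ->]]].
  rewrite -ratr_pair_diamT ler_rat; apply: h; right; apply: mem => // ab'.
  by apply: ab; rewrite ab'.
move=> h; rewrite rmorph0 min_pair_diam_trivial //.
move=> _ _ /real_clusterP[a aS ->] /real_clusterP[b bS ->].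
have [-> //|/eqP ab] := eqVneq a b.
by case: (h (pair_diamT a b).1); right; exact: mem.
Qed.

Definition lefter u v : Prop := u.1 < v.1 \/ u.1 = v.1 /\ qpos u 1 <= qpos v 1.

Lemma lefterTP u v : reflect (lefter u v) (lefterT u v).1.
Proof.
rewrite /lefter /lefterT /= -/(qpos u 1) -/(qpos v 1).
have [uv|vu|uv] := ltrgtP u.1 v.1 => /=; first by left; left.
  by rewrite vu; right; case=> // -[] /eqP; rewrite gt_eqF.
rewrite uv ltxx; by apply: (iffP idP) => [|[//|[]//]]; right.
Qed.

Lemma lefter_trans u v w : lefter u v -> lefter v w -> lefter u w.
Proof.
move=> [uv|[uv uv']] [vw|[vw vw']].
- by left; exact: lt_trans vw.
- by left; rewrite -vw.
- by left; rewrite uv.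
- by right; split; [rewrite uv|exact: le_trans vw'].
Qed.

Lemma lefter_total u v : lefter u v \/ lefter v u.
Proof.
have [uv|vu|uv] := ltrgtP u.1 v.1; [by left; left|by right; left|].
have [h|/ltW h] := leP (qpos u 1) (qpos v 1); [left|right]; right; split=> //.
Qed.

Lemma lefter_refl u : lefter u u. Proof. by right. Qed.

Lemma leftmostT_val u S : let r := (leftmostT u S).1 in
  r \in u :: S /\ forall v, v \in u :: S -> lefter r v.
Proof.
elim: S u => [|v S IH] u.
  by split; [rewrite inE|move=> w; rewrite inE => /eqP ->; exact: lefter_refl].
set m := if (lefterT v u).1 then v else u.
rewrite -[(leftmostT _ _).1]/(leftmostT m S).1 /=; have [rm rmin] := IH m.
have [mv mu] : lefter m v /\ lefter m u.
  rewrite /m; case: lefterTP => h; first by split=> //; exact: lefter_refl.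
  by split; [case: (lefter_total v u)|exact: lefter_refl].
split.
  move: rm; rewrite !inE => /orP[/eqP ->|->]; last by rewrite !orbT.
  by rewrite /m; case: ifP => _; rewrite eqxx ?orbT.
move=> w; rewrite !inE => /or3P[/eqP ->|/eqP ->|wS].
- by apply: lefter_trans mu; apply: rmin; rewrite mem_head.
- by apply: lefter_trans mv; apply: rmin; rewrite mem_head.
- by apply: rmin; rewrite inE wS orbT.
Qed.

Lemma leftmostT_real u S : leftmost (rc (u :: S)) = rt (leftmostT u S).1 :> traj R.
Proof.
have [rm rmin] := leftmostT_val u S; apply: leftmost_eq; split.
  by rewrite mem_real_cluster.
move=> _ /real_clusterP[v /rmin rv ->].
have p0 w : pos (rt w) 0 = ratr w.1 by rewrite /pos mulr0 addr0.
have p1 w : pos (rt w) 1 = ratr (qpos w 1) by rewrite -pos_ratr rmorph1.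
by rewrite !p0 !p1 ltr_rat ler_rat; case: rv => [|[-> h]]; [left|right].
Qed.

Lemma splitT_val D u (near : pred qtraj) S :
  (forall v, near v = ((pair_diamT u v).1 <= D)) ->
  (splitT D u S).1 = ([seq v <- S | near v], [seq v <- S | ~~ near v]).
Proof.
move=> nearE; elim: S => // v S IH; have -> : (splitT D u (v :: S)).1 =
  if (pair_diamT u v).1 <= D then (v :: (splitT D u S).1.1, (splitT D u S).1.2)
  else ((splitT D u S).1.1, v :: (splitT D u S).1.2) by [].
by rewrite IH -nearE /=; case: (near v).
Qed.

(** The depth is the same on both sides, so the recursions advance together; [uniq] enters
    afterwards, to match [size S] with the cardinal of the real cluster. *)
Lemma greedy_recT_val d S D :
  map rc (greedy_recT d S D).1 = greedy_rec d (rc S) (ratr D).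
Proof.
elim: d S => // d IH [|u S].
  by rewrite /= /real_cluster (_ : [fset _ | _ in _]%fset = fset0) ?eqxx //;
     apply/fsetP => x; rewrite inE; apply/negP => /imfsetP[].
set s := (leftmostT u S).1; set p := (splitT D s (u :: S)).1.
have -> : (greedy_recT d.+1 (u :: S) D).1 = p.1 :: (greedy_recT d p.2 D).1 by [].
rewrite greedy_recS (negPf (real_cluster_neq0 R (isT : u :: S != [::]))).
(* The existential makes the test opaque to simplification. *)
have [near nearE] : exists near : pred qtraj, forall v, near v = ((pair_diamT s v).1 <= D).
  by exists (fun v => (pair_diamT s v).1 <= D).
have pE := splitT_val (u :: S) nearE; rewrite -/p in pE.
have cE : rc p.1 = greedy_cluster (rc (u :: S)) (ratr D).
  apply/fsetP => x; rewrite mem_greedy_cluster leftmostT_real -/s pE; apply/real_clusterP/idP.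
    move=> [v]; rewrite mem_filter => /andP[vD vS] ->.
    by rewrite mem_real_cluster vS -ratr_pair_diamT ler_rat -nearE.
  move=> /andP[/real_clusterP[v vS ->]].
  by rewrite -ratr_pair_diamT ler_rat -nearE => vD; exists v; rewrite ?mem_filter ?vD.
rewrite map_cons IH -cE; congr (_ :: greedy_rec _ _ _).
apply/fsetP => x; rewrite in_fsetD; apply/real_clusterP/andP.
  move=> [v +] ->; rewrite !mem_real_cluster pE !mem_filter => /andP[/negPf -> ->].
  by [].
move=> [+ /real_clusterP[v vS xE]]; rewrite xE mem_real_cluster pE => h.
by exists v => //; move: h; rewrite !mem_filter vS !andbT.
Qed.

Lemma GreedyPartitionT_val S D : uniq S ->
  map rc (GreedyPartitionT S D).1 = GreedyPartition (rc S) (ratr D).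
Proof. by move=> uS; rewrite /GreedyPartition card_real_cluster // greedy_recT_val. Qed.

End AlgorithmValues.

(** * Running time of the loop *)

Section LoopSimulation.
Variables (S : seq qtraj) (k : nat).
Notation B := (diamT S).1.
Notation mp := (min_pair_diamT S).1.
Variables (h H n hB J : nat).
Hypotheses (S_small : smalls H S) (size_n : (size S <= n)%N).
Hypotheses (B_le : hle hB B) (mp_le : hle (14 * H + 12) mp).
(** Height of [B * p / 2 ^ j]: both [p] and [2 ^ j] have height at most J + 1. *)
Notation hs := (hB + 2 * J + 2)%N.
Hypothesis h_large : (14 * H + 12 + (2 * hs + 3) + n + nbits k <= h)%N.

(* After j steps, a and b are consecutive multiples of B / 2^j; bounding the sizes of
   a and b step by step would only give an exponential bound. *)
Definition dyadic (j : nat) (st : bs_stateT) : Prop :=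
  (exists p : nat, [/\ (p < 2 ^ j)%N, st.1.1 = B * p%:R / 2 ^+ j
                     & st.1.2 = B * p.+1%:R / 2 ^+ j])
  /\ forall G, st.2 = Some G -> (size G <= n)%N.

Lemma hgt_dyadic (p j : nat) : (p <= 2 ^ j)%N -> (j <= J)%N -> hle hs (B * p%:R / 2 ^+ j).
Proof.
move=> pj jJ; rewrite /hle.
have e1 : (hgt (2 ^+ j) <= j.+1)%N by rewrite -natrX; apply: hgt_nat; rewrite ?ltn_exp2l.
have e2 : (hgt p%:R <= j.+1)%N.
  by apply: hgt_nat => //; apply: leq_ltn_trans pj _; rewrite ltn_exp2l.
have hBB : (hgt B <= hB)%N := B_le.
apply: leq_trans (hgt_div _ _) _.
have : (hgt (B * p%:R) <= hB + j.+1)%N by apply: leq_trans (hgtM _ _) _; exact: leq_add.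
move: (hgt (B * _)) (hgt (2 ^+ j)) e1 => x y; lia.
Qed.

Lemma dyadic_hle j st : dyadic j st -> (j <= J)%N -> hle hs st.1.1 /\ hle hs st.1.2.
Proof.
by case=> [[p [pj -> ->]] _] jJ; split; apply: hgt_dyadic => //; exact: ltnW.
Qed.

Lemma dyadic_init : dyadic 0 (0, B, None).
Proof.
split=> //; exists 0%N; rewrite expn0; split=> //=.
  by rewrite mulr0 mul0r.
by rewrite mulr1 divr1.
Qed.

Notation cgreedy := (n * (43 * n + 8) + 1)%N.

Lemma costs_greedy D a : hle a D -> (a <= h)%N ->
  costs h (GreedyPartitionT S D) (fun G => size G <= n)%N cgreedy.
Proof.
move=> Da ah; have hp : (14 * H + 12 <= h)%N by lia.
apply: costsW (costs_greedy_rec hp (size S) Da ah S_small size_n) _ _.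
  by move=> G /leq_trans; apply.
by rewrite leq_add2r leq_mul2r size_n orbT.
Qed.

Lemma costs_longer (G : seq (seq qtraj)) : (size G <= n)%N ->
  costs h (longerT G k) (fun c => c = (k < size G)%N) 1.
Proof.
move=> Gn; split=> //; rewrite mul1n /= /tick leq_sqr; lia.
Qed.

Lemma costs_test (R : realType) (eps : R) j st : dyadic j st -> (j <= J)%N ->
  costs h (bs_testT (delta_coef eps) mp st) (fun _ => True) 3.
Proof.
move=> dy jJ; have [ha hb] := dyadic_hle dy jJ.
case: st ha hb {dy} => [[a b] last] /= ha hb.
apply: costs_bind1 (costs_sub (c := 2 * hs + 1) hb ha _ _ _) _; try lia; move=> w hw.
split=> //; rewrite mul1n; apply: opcost_tick; first by apply: leq_trans mp_le _; lia.
by apply: leq_trans hw _; lia.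
Qed.

Lemma costs_body j st : dyadic j st -> (j <= J)%N ->
  costs h (bs_bodyT S k st) (dyadic j.+1) (cgreedy + 10).
Proof.
move=> dy jJ; have [ha hb] := dyadic_hle dy jJ.
case: st ha hb dy => [[a b] last] /= ha hb [[p [pj /= aE bE]] _].
pose D := (a + b) / 2.
have DE : D = B * (2 * p + 1)%:R / 2 ^+ j.+1.
  rewrite /D aE bE /= exprS -natr1 natrD natrM; field.
  by rewrite expf_neq0.
suff : costs h (bs_bodyT S k (a, b, last))
   (fun st => exists G, (size G <= n)%N /\ (st = (D, b, Some G) \/ st = (a, D, Some G)))
   (cgreedy + 10).
  move=> hc; apply: costsW hc _ _ => // st [G [Gn [->|->]]]; split=> //=;
    try by move=> _ [<-].
    exists (2 * p + 1)%N; split; first by rewrite expnS; lia.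
      exact: DE.
    by rewrite bE exprS (_ : (2 * p + 1).+1 = 2 * p.+1)%N ?natrM;
      [field; rewrite expf_neq0|lia].
  exists (2 * p)%N; split; first by rewrite expnS; lia.
    by rewrite aE exprS natrM; field; rewrite expf_neq0.
  by rewrite DE addn1.
rewrite /bs_bodyT (_ : cgreedy + 10 = (cgreedy + 6).+2.+2)%N; last by lia.
(* The exact value is kept beside the height, since the dyadic form of the next state rests on
   it. *)
apply: (@costs_bind1 _ _ _ _ _ (fun x => x = a + b /\ hle (2 * hs + 1) x)).
  have [] := costs_add (c := 2 * hs + 1) ha hb (_ : _ <= h)%N (_ : _ <= h)%N
    (_ : _ <= _)%N; try lia.
  by move=> ? ?; split.
move=> _ [-> hab].
apply: (@costs_bind1 _ _ _ _ _ (fun x => x = D /\ hle (2 * hs + 3) x)).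
  have [] := costs_div (c := 2 * hs + 3) hab hle2 (_ : _ <= h)%N (_ : _ <= h)%N
    (_ : _ <= _)%N; try lia.
  by move=> ? ?; split.
move=> _ [-> hD].
apply: (costs_bind (j2 := 3) (costs_greedy hD _)); try lia; move=> G Gn.
apply: costs_bind1 (costs_longer Gn) _ => c _.
by apply: costs_ret => //; exists G; split=> //; case: c; [left|right].
Qed.

Lemma costs_return j st : dyadic j st -> (j <= J)%N ->
  costs h (bs_returnT S k st) (fun _ => True) (cgreedy + 2).
Proof.
move=> dy jJ; have [_ hb] := dyadic_hle dy jJ.
case: st hb dy => [[a b] [G|]] /= hb [_ Gn]; last first.
  by apply: costsW (costs_greedy hb _) _ _ => //; lia.
rewrite addn2; apply: costs_bind1 (costs_longer (Gn _ erefl)) _ => -[] _.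
  by apply: costsW (costs_greedy hb _) _ _ => //; lia.
by apply: costs_ret => //; lia.
Qed.

Variables (R : realType) (eps : R).
Hypothesis S_uniq : uniq S.
Notation rc := (@real_cluster R).

Definition real_state (st : bs_stateT) : bs_state R :=
  (ratr st.1.1, ratr st.1.2, omap (map rc) st.2).

Lemma real_test st :
  (bs_testT (delta_coef eps) mp st).1 = bs_test eps (rc S) (real_state st).
Proof.
case: st => [[a b] last].
have -> : (bs_testT (delta_coef eps) mp (a, b, last)).1 =
  (delta_coef eps * ratr mp < ratr (b - a)) by [].
by rewrite min_pair_diamT_val // rmorphB.
Qed.

Lemma real_body st :
  real_state (bs_bodyT S k st).1 = bs_body (rc S) k (real_state st).
Proof.
case: st => [[a b] last].
pose G := (GreedyPartitionT S ((a + b) / 2)).1.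
have -> : (bs_bodyT S k (a, b, last)).1 =
  if (k < size G)%N then ((a + b) / 2, b, Some G) else (a, (a + b) / 2, Some G) by [].
have GE : map rc G = GreedyPartition (rc S) ((ratr a + ratr b) / 2).
  by rewrite GreedyPartitionT_val // fmorph_div /= rmorphD rmorph_nat.
rewrite /bs_body /real_state [(_, _, _).1.1]/= -GE size_map.
by case: ifP => _ /=; rewrite fmorph_div /= rmorphD rmorph_nat.
Qed.

Lemma real_return st :
  map rc (bs_returnT S k st).1 = bs_return (rc S) k (real_state st).
Proof.
case: st => [[a b] [G|]]; last exact: GreedyPartitionT_val.
have -> : (bs_returnT S k (a, b, Some G)).1 =
  if (k < size G)%N then (GreedyPartitionT S b).1 else G by rewrite /=; case: ifP.
rewrite /bs_return /= size_map; case: ifP => // _.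
exact: GreedyPartitionT_val.
Qed.

Hypothesis J_large : ratr B <= delta_coef eps * ratr mp * 2 ^+ J.

(** [j] counts halvings done and [m] those still allowed. An iteration costs 3 for the test,
    [cgreedy + 10] for the body and 1 for the loop; a last failing test costs 3. *)
Lemma loop_simulation m j st : dyadic j st -> (j + m)%N = J ->
  exists r, [/\ WhileT (bs_testT (delta_coef eps) mp) (bs_bodyT S k) st r,
    While (bs_test eps (rc S)) (bs_body (rc S) k) (real_state st) (real_state r.1),
    (r.2 <= (m * (cgreedy + 14) + 3) * tick h)%N
    & exists2 j', (j' <= J)%N & dyadic j' r.1].
Proof.
elim: m j st => [|m IH] j st dy jm.
  have jJ : (j <= J)%N by lia.
  (* After [J] halvings the gap is [B / 2 ^ J], which [J_large] puts below the threshold. *)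
  have t : (bs_testT (delta_coef eps) mp st).1 = false.
    case: dy => [[p [pj aE bE]] _]; case: st aE bE => [[a b] last] /= aE bE.
    apply/negbTE; rewrite -leNgt.
    have -> : b - a = B / 2 ^+ j.
      by rewrite aE bE -natr1; field; rewrite expf_neq0.
    rewrite addn0 in jm; rewrite jm fmorph_div /= rmorphXn /= rmorph_nat.
    by rewrite ler_pdivrMr ?exprn_gt0.
  exists (st, (bs_testT (delta_coef eps) mp st).2); split.
  - exact: WhileT_stop.
  - by apply: While_stop; rewrite -real_test.
  - by have [_] := costs_test eps dy jJ.
  - by exists j.
have jJ : (j <= J)%N by lia.
have [_ tc] := costs_test eps dy jJ.
have [t|/negbTE t] := boolP (bs_testT (delta_coef eps) mp st).1; last first.
  exists (st, (bs_testT (delta_coef eps) mp st).2); split.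
  - exact: WhileT_stop.
  - by apply: While_stop; rewrite -real_test.
  - by apply: leq_trans tc _; rewrite leq_mul2r leq_addl orbT.
  - by exists j.
have [dy' bc] := costs_body dy jJ.
have jm' : (j.+1 + m)%N = J by rewrite addSnnS.
have [[st' c] [w1 w2 wc wd]] := IH _ _ dy' jm'.
exists (st', ((bs_testT (delta_coef eps) mp st).2 + (bs_bodyT S k st).2 + c).+1); split.
- exact: WhileT_step.
- by apply: While_step; rewrite -?real_test -?real_body.
- have t0 := tick_gt0 h; rewrite /= in wc; rewrite [X in (X <= _)%N]/=.
  have := leq_add (leq_add (leq_add tc bc) wc) t0; rewrite addn1 => /leq_trans; apply.
  by rewrite -[X in (_ + X)%N]mul1n -!mulnDl leq_mul2r mulSn; apply/orP; right; lia.
- by [].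
Qed.

End LoopSimulation.

(** * Assembling the polynomial time bound *)

Section PolynomialBound.

Definition polynomial_fun (F : nat -> nat) := exists p : {poly nat}, forall N, F N = p.[N].

Lemma polynomial_fun_cst c : polynomial_fun (fun _ => c).
Proof. by exists c%:P => N; rewrite hornerC. Qed.

Lemma polynomial_fun_id : polynomial_fun (fun N => N).
Proof. by exists 'X => N; rewrite hornerX. Qed.

Lemma polynomial_funD F G : polynomial_fun F -> polynomial_fun G ->
  polynomial_fun (fun N => F N + G N)%N.
Proof. by move=> [p hp] [q hq]; exists (p + q) => N; rewrite hornerD hp hq. Qed.

Lemma polynomial_funM F G : polynomial_fun F -> polynomial_fun G ->
  polynomial_fun (fun N => F N * G N)%N.
Proof. by move=> [p hp] [q hq]; exists (p * q) => N; rewrite hornerM hp hq. Qed.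

Lemma polynomial_fun_sqr F : polynomial_fun F -> polynomial_fun (fun N => F N ^ 2)%N.
Proof. by move=> hF; exact: (polynomial_funM hF hF). Qed.

Lemma size_input_le s k : (size s <= input_size s k)%N.
Proof.
rewrite /input_size -sum1_size; apply: leq_trans (leq_addl _ _).
by apply: leq_sum => u _; rewrite /bits; lia.
Qed.

Lemma smalls_input s k : smalls (input_size s k) s.
Proof.
move=> u us; have : (bits u.1 + bits u.2 <= input_size s k)%N.
  by rewrite /input_size (big_rem u us) /=; lia.
move=> hu; split; rewrite /hle; apply: leq_trans (hgt_le_bits _) (leq_trans _ hu);
  by rewrite ?leq_addr ?leq_addl.
Qed.

Variables (R : realType) (eps : R).
Hypothesis eps0 : 0 < eps.

(** The only way in which [eps] enters the time bound: [c] extra halvings, independent of the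
    input. *)
Lemma delta_coef_ge_exp2 : exists c, (2 ^+ c)^-1 <= delta_coef eps.
Proof.
have d0 := delta_coef_gt0 eps0.
exists (Num.Def.truncn (delta_coef eps)^-1).+1.
rewrite -[leRHS]invrK lef_pV2 ?posrE ?exprn_gt0 ?invr_gt0 //.
have q0 : 0 <= (delta_coef eps)^-1 by rewrite invr_ge0 ltW.
apply: le_trans (ltW (truncnS_gt _)) _.
by rewrite -natrX ler_nat ltnW // ltn_expl.
Qed.

(** The exponent adds the logarithms of an upper bound for the diameter and of lower bounds for the
    two factors of the threshold. *)
Lemma iterations_suffice s hB c : uniq s -> s != [::] -> hle hB (diamT s).1 ->
  forall N, hle (14 * N + 12) (min_pair_diamT s).1 -> (2 ^+ c)^-1 <= delta_coef eps ->
  ratr (diamT s).1 <=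
    delta_coef eps * ratr (min_pair_diamT s).1 * 2 ^+ (hB + (14 * N + 12) + c).
Proof.
move=> us s0 Bh N mh cd.
have [s1|s1] := leqP (size s) 1.
  by rewrite diamT_val // min_pair_diamT_val // card_small_diam ?min_pair_diam_small
    ?card_real_cluster // mulr0 mul0r.
have m0 : 0 < (min_pair_diamT s).1.
  by rewrite -(ltr0q R) min_pair_diamT_val // min_pair_diam_gt0 // card_real_cluster.
have e2 n : (0 : R) < 2 ^+ n by rewrite exprn_gt0.
have Ble : ratr (diamT s).1 <= 2 ^+ hB :> R.
  rewrite -(rmorph_nat (@ratr R)) -rmorphXn /= ler_rat.
  apply: le_trans (ler_norm _) (le_trans (hgt_le_exp2 _) _).
  by rewrite ler_eXn2l // ltr1n.
have mge : (2 ^+ (14 * N + 12))^-1 <= ratr (min_pair_diamT s).1 :> R.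
  rewrite -(rmorph_nat (@ratr R)) -rmorphXn -fmorphV /= ler_rat.
  apply: le_trans (hgt_ge_exp2 m0).
  by rewrite lef_pV2 ?posrE ?exprn_gt0 // ler_eXn2l // ltr1n.
apply: le_trans Ble _.
have prod : (2 ^+ c)^-1 * (2 ^+ (14 * N + 12))^-1
    <= delta_coef eps * ratr (min_pair_diamT s).1.
  by apply: ler_pM => //; rewrite invr_ge0 ltW.
apply: le_trans (ler_wpM2r (ltW (e2 _)) prod).
rewrite !exprD le_eqVlt; apply/orP; left; apply/eqP; field.
by rewrite !expf_neq0.
Qed.

Lemma kclusteringBS_polynomial : exists p : {poly nat},
  forall (s : seq (rat * rat)) (k : nat), uniq s -> (1 <= k)%N -> (k <= size s)%N ->
  exists (CC : seq (seq (rat * rat))) (T : nat),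
    [/\ kclusteringBS_runs eps s k CC T,
        kclusteringBS eps (real_cluster R s) k (map (real_cluster R) CC)
      & (T <= p.[input_size s k])%N].
Proof.
have [c hc] := delta_coef_ge_exp2.
pose hB N := ((1 + N * N) * (32 * N + 23) + 1)%N.
pose J N := (hB N + (14 * N + 12) + c)%N.
pose h N := (14 * N + 12 + (2 * (hB N + 2 * J N + 2) + 3) + N + N)%N.
(* The summands are the least pair distance, the diameter, the loop and the final call, in units of
   [tick (h N)]; the input size [N] bounds the number of trajectories, their heights and the length
   of [k] at once. *)
pose F N := ((N * (27 * N + 2) + 3
  + (N * (N * (4 * (1 + N * N) + 20) + 3) + (1 + N * N) * (12 * N + 20) + 12 * N + 12)
  + (J N * (N * (43 * N + 8) + 1 + 14) + 3) + (N * (43 * N + 8) + 1 + 2))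
  * tick (h N))%N.
have [p hp] : polynomial_fun F.
  rewrite /F /tick /h /J /hB.
  by repeat first [exact: polynomial_fun_cst | exact: polynomial_fun_id
    | apply: polynomial_funD | apply: polynomial_funM | apply: polynomial_fun_sqr].
exists p => s k us k1 ks.
have s0 : s != [::] by case: s ks {us} => //; rewrite leqNgt k1.
set N := input_size s k.
have sN : (size s <= N)%N := size_input_le s k.
have kN : (nbits k <= N)%N by exact: leq_addr.
have sm : smalls N s := @smalls_input s k.
have hpair : (14 * N + 12 <= h N)%N by rewrite /h; lia.
have [mh mc] := costs_min_pair hpair sm sN.
have hBh : (hB N <= h N)%N by rewrite /h; lia.
have [Bh Bc] := costs_diam hpair sm sN hBh.
have Jok := iterations_suffice us s0 Bh mh hc.
have hl : (14 * N + 12 + (2 * (hB N + 2 * J N + 2) + 3) + N + nbits k <= h N)%N.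
  by rewrite /h; lia.
have [r [w1 w2 wc [j jJ dy]]] :=
  loop_simulation sm sN Bh mh hl us Jok (dyadic_init s N) (add0n (J N)).
have [_ oc] := costs_return sm sN Bh hl dy jJ.
exists (bs_returnT s k r.1).1.
exists ((min_pair_diamT s).2 + (diamT s).2 + r.2 + (bs_returnT s k r.1).2)%N; split.
- by exists r.
- exists (real_state R r.1); last by rewrite real_return.
  by move: w2; rewrite /real_state /= diamT_val // rmorph0.
- rewrite -hp /F 3!mulnDl.
  by apply: leq_add oc; apply: leq_add wc; apply: leq_add mc Bc.
Qed.

End PolynomialBound.

Theorem theorem4p8 (R : realType) (eps : R) (heps : 0 < eps) :
  (forall (n k : nat) (S : {fset traj R}),
     #|` S| = n -> (1 <= k)%N -> (k <= n)%N ->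
     exists CC : seq {fset traj R},
       [/\ kclusteringBS eps S k CC,
           kclustering S k CC
         & ((k = n) -> (1 < n)%N -> eps < (4 + Num.sqrt 2) / 2) ->
           md CC <= ((4 + Num.sqrt 2) / 2 + eps) * md_star S k])
  /\
  (exists p : {poly nat},
     forall (s : seq (rat * rat)) (k : nat),
       uniq s -> (1 <= k)%N -> (k <= size s)%N ->
       exists (CC : seq (seq (rat * rat))) (T : nat),
         [/\ kclusteringBS_runs eps s k CC T,
             kclusteringBS eps (real_cluster R s) k (map (real_cluster R) CC)
           & (T <= p.[input_size s k])%N]).
Proof.
split; last exact: kclusteringBS_polynomial.
by move=> n k S <- k1 kn; exact: kclusteringBS_approx.
Qed.
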